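(* For any involutory quandle $X$ there is a 2-functor $$\mathrm{Col}_X:\mathcal{T}ang\to\mathbf{Span}(\mathbf{Set})$$ given as follows. On an object $n$ of $\mathcal{T}ang$, $\mathrm{Col}_X(n)=X^n$ is the set of $n$-tuples of elements of $X$. On a tangle diagram $T:m\to n$, $\mathrm{Col}_X(T)$ is the span $$X^m\leftarrow\mathrm{Col}_X(T)\rightarrow X^n$$ whose middle set is the set of $X$-colorings of $T$, whose left arrow sends a coloring of $T$ to the coloring it induces on the lower endpoints of $T$, and whose right arrow sends a coloring to the coloring it induces on the upper endpoints. On a generating 2-isomorphism, i.e. a local move replacing one tangle diagram $T$ by another $T'$ inside a disk, $\mathrm{Col}_X$ is the bijection $\mathrm{Col}_X(T)\to\mathrm{Col}_X(T')$ sending a coloring of $T$ to the unique coloring of $T'$ that agrees with it outside the disk.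
   Context: A quandle is a set $Q$ with two binary operations $\triangleright,\triangleleft$ such that for all $a,b,c\in Q$: (Q1) $a\triangleright a=a$; (Q2) $(b\triangleright a)\triangleleft b=a=b\triangleright(a\triangleleft b)$; (Q3) $a\triangleright(b\triangleright c)=(a\triangleright b)\triangleright(a\triangleright c)$. It is involutory if moreover $b\triangleright a=a\triangleleft b$ for all $a,b$. $\mathcal{T}ang$ is the strict monoidal 2-category of unoriented tangle diagrams. Its objects are the natural numbers, with $m\otimes n=m+n$. Its 1-morphisms $m\to n$ are tangle diagrams with $m$ endpoints on the bottom and $n$ on the top, built by composition and $\otimes$ from the generators $X^+,X^-:2\to2$ (right- and left-handed crossings; in $X^+$ the over-strand runs from bottom left to top right, in $X^-$ from bottom right to top left), $\cup:0\to2$ (local minimum) and $\cap:2\to0$ (local maximum), subject to the axioms of a strict monoidal category. Composition is written in diagrammatic order: for $T_1:m\to l$ and $T_2:l\to n$, $T_1\circ T_2:m\to n$ stacks $T_2$ on top of $T_1$; $\otimes$ is side-by-side juxtaposition; $I_n$ is the identity on $n$. Its 2-morphisms are generated, under vertical and horizontal composition and $\otimes$, by freely adjoined 2-isomorphisms between the two sides of each of the following relations (local moves): $T_0$: $(\cup\otimes I_1)\circ(I_1\otimes\cap)= I_1=(I_1\otimes\cup)\circ(\cap\otimes I_1)$; $T_0'$: $(I_1\otimes\cup)\circ(X^\pm\otimes I_1)=(\cup\otimes I_1)\circ(I_1\otimes X^\mp)$; $T_1$: $\cup\circ X^\pm=\cup$; $T_2$: $X^\pm\circ X^\mp=I_2$;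 $T_3$: $(X^+\otimes I_1)\circ(I_1\otimes X^+)\circ(X^+\otimes I_1)=(I_1\otimes X^+)\circ(X^+\otimes I_1)\circ(I_1\otimes X^+)$. An arc of a tangle diagram is a maximal piece of the diagram whose ends are undercrossings or free endpoints (a closed component with no undercrossings counts as one arc). An $X$-coloring is an assignment of an element of $X$ to each arc such that at each crossing with over-arc colored $b$ and one under-arc colored $a$, the other under-arc is colored $b\triangleright a$ (independent of which under-arc is called the first, since $X$ is involutory). For a category $\mathcal{C}$ with pullbacks, $\mathbf{Span}(\mathcal{C})$ is the (weak) 2-category with the objects of $\mathcal{C}$; a morphism $A\to B$ is a span $A\xleftarrow{f_l}F\xrightarrow{f_r}B$ in $\mathcal{C}$; a 2-morphism from $A\xleftarrow{f_l}F\xrightarrow{f_r}B$ to $A\xleftarrow{g_l}G\xrightarrow{g_r}B$ is an arrow $\phi:F\to G$ with $g_l\phi=f_l$ and $g_r\phi=f_r$. The composite of $A\leftarrow F\to B$ with $B\leftarrow G\to C$ has as middle object the pullback of $F\to B\leftarrow G$; composition is associative up to canonical 2-isomorphism, and ''2-functor'' is understood in the weak sense (preserving composition and identities up to coherent 2-isomorphism).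
   Formalization: The interchange law (f⊗I)∘(I⊗f')=(I⊗f')∘(f⊗I) for tangle diagrams is not an equation but a freely adjoined 2-isomorphism, coherent as in a semistrict monoidal 2-category; with strict interchange closed diagrams commute and Col_X on moves is ill-defined. *)

(* Defs.v *)
From mathcomp Require Import all_boot.
From mathcomp Require Import boolp.
From Stdlib Require Import Relation_Operators.

Set Implicit Arguments.
Unset Strict Implicit.
Unset Printing Implicit Defensive.

#[local] Obligation Tactic := idtac.

(* [quot R] is the quotient of [T] by the equivalence relation generated by
   [R]; its elements are the equivalence classes, as predicates on [T]. *)
Definition eclass (T : Type) (R : T -> T -> Prop) (x : T) : T -> Prop :=
  clos_refl_sym_trans T R x.

Record quot (T : Type) (R : T -> T -> Prop) := Quot {
  quot_pred :> T -> Prop;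
  quotP : exists x, quot_pred = eclass R x }.

Definition qpi (T : Type) (R : T -> T -> Prop) (x : T) : quot R :=
  @Quot T R (eclass R x) (ex_intro _ x erefl).

Definition qrepr (T : Type) (R : T -> T -> Prop) (q : quot R) : T :=
  projT1 (cid (quotP q)).

Lemma quot_inj T (R : T -> T -> Prop) (p q : quot R) :
  quot_pred p = quot_pred q -> p = q.
Proof.
case: p q => [p pP] [q qP] /= E; case: q / E in qP *.
by rewrite (Prop_irrelevance pP qP).
Qed.

Lemma qreprK T (R : T -> T -> Prop) (q : quot R) : qpi R (qrepr q) = q.
Proof. by apply: quot_inj; rewrite /qrepr /=; case: cid. Qed.

Lemma eq_qpi T (R : T -> T -> Prop) x y : eclass R x y -> qpi R x = qpi R y.
Proof.
move=> xy; apply: quot_inj => /=; apply: funext => z; apply: propext.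
split=> h; last exact: rst_trans h.
by apply: rst_trans h; apply: rst_sym.
Qed.

Lemma qpi_eq T (R : T -> T -> Prop) x y : qpi R x = qpi R y -> eclass R x y.
Proof. by case=> ->; apply: rst_refl. Qed.

Lemma qreprP T (R : T -> T -> Prop) x : eclass R (qrepr (qpi R x)) x.
Proof. by apply: qpi_eq; rewrite qreprK. Qed.

Record quandle := Quandle {
  qcar :> Type;
  qr : qcar -> qcar -> qcar;
  ql : qcar -> qcar -> qcar;
  quandle1 : forall a, qr a a = a;
  quandle2l : forall a b, ql (qr b a) b = a;
  quandle2r : forall a b, qr b (ql a b) = a;
  quandle3 : forall a b c, qr a (qr b c) = qr (qr a b) (qr a c) }.

Notation "a |> b" := (qr a b) (at level 40, left associativity).
Notation "a <| b" := (ql a b) (at level 40, left associativity).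

Definition involutory (X : quandle) := forall a b : X, b |> a = a <| b.

(* [comp1], [vcomp] and [hcomp] are in diagrammatic order. *)
Record bicat_data := BicatData {
  ob :> Type;
  hom : ob -> ob -> Type;
  cell : forall a b, hom a b -> hom a b -> Type;
  id1 : forall a, hom a a;
  comp1 : forall a b c, hom a b -> hom b c -> hom a c;
  id2 : forall a b (f : hom a b), cell f f;
  vcomp : forall a b (f g h : hom a b), cell f g -> cell g h -> cell f h;
  hcomp : forall a b c (f g : hom a b) (f' g' : hom b c),
    cell f g -> cell f' g' -> cell (comp1 f f') (comp1 g g');
  assoc : forall a b c d (f : hom a b) (g : hom b c) (h : hom c d),
    cell (comp1 (comp1 f g) h) (comp1 f (comp1 g h));
  lunit : forall a b (f : hom a b), cell (comp1 (id1 a) f) f;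
  runit : forall a b (f : hom a b), cell (comp1 f (id1 b)) f }.

Arguments hom {_}.
Arguments cell {_ _ _}.
Arguments id1 {_}.
Arguments comp1 {_ _ _ _}.
Arguments id2 {_ _ _}.
Arguments vcomp {_ _ _ _ _ _}.
Arguments hcomp {_ _ _ _ _ _ _ _}.
Arguments assoc {_ _ _ _ _}.
Arguments lunit {_ _ _}.
Arguments runit {_ _ _}.

Definition invertible (C : bicat_data) (a b : C) (f g : hom a b)
    (x : cell f g) : Prop :=
  exists y : cell g f, vcomp x y = id2 f /\ vcomp y x = id2 g.

Record bicategory := Bicategory {
  bicat :> bicat_data;
  vcompA : forall (a b : bicat) (f g h k : hom a b)
    (x : cell f g) (y : cell g h) (z : cell h k),
    vcomp x (vcomp y z) = vcomp (vcomp x y) z;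
  vcomp1l : forall (a b : bicat) (f g : hom a b) (x : cell f g),
    vcomp (id2 f) x = x;
  vcomp1r : forall (a b : bicat) (f g : hom a b) (x : cell f g),
    vcomp x (id2 g) = x;
  hcomp_id2 : forall (a b c : bicat) (f : hom a b) (g : hom b c),
    hcomp (id2 f) (id2 g) = id2 (comp1 f g);
  interchange : forall (a b c : bicat) (f g h : hom a b) (f' g' h' : hom b c)
    (x : cell f g) (y : cell g h) (x' : cell f' g') (y' : cell g' h'),
    hcomp (vcomp x y) (vcomp x' y') = vcomp (hcomp x x') (hcomp y y');
  assoc_inv : forall (a b c d : bicat)
    (f : hom a b) (g : hom b c) (h : hom c d), invertible (assoc f g h);
  lunit_inv : forall (a b : bicat) (f : hom a b), invertible (lunit f);
  runit_inv : forall (a b : bicat) (f : hom a b), invertible (runit f);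
  assoc_nat : forall (a b c d : bicat) (f f' : hom a b) (g g' : hom b c)
    (h h' : hom c d) (x : cell f f') (y : cell g g') (z : cell h h'),
    vcomp (hcomp (hcomp x y) z) (assoc f' g' h')
    = vcomp (assoc f g h) (hcomp x (hcomp y z));
  lunit_nat : forall (a b : bicat) (f g : hom a b) (x : cell f g),
    vcomp (hcomp (id2 (id1 a)) x) (lunit g) = vcomp (lunit f) x;
  runit_nat : forall (a b : bicat) (f g : hom a b) (x : cell f g),
    vcomp (hcomp x (id2 (id1 b))) (runit g) = vcomp (runit f) x;
  triangle : forall (a b c : bicat) (f : hom a b) (g : hom b c),
    vcomp (assoc f (id1 b) g) (hcomp (id2 f) (lunit g))
    = hcomp (runit f) (id2 g);
  pentagon : forall (a b c d e : bicat)
    (f : hom a b) (g : hom b c) (h : hom c d) (k : hom d e),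
    vcomp (vcomp (hcomp (assoc f g h) (id2 k)) (assoc f (comp1 g h) k))
          (hcomp (id2 f) (assoc g h k))
    = vcomp (assoc (comp1 f g) h k) (assoc f g (comp1 h k)) }.

(* The weak 2-functors (pseudofunctors) with prescribed action [F0] on objects
   and [F1] on 1-morphisms. *)
Record pseudofunctor (C D : bicategory) (F0 : C -> D)
    (F1 : forall a b : C, hom a b -> hom (F0 a) (F0 b)) := Pseudofunctor {
  F2 : forall (a b : C) (f g : hom a b), cell f g -> cell (F1 a b f) (F1 a b g);
  F2_id : forall (a b : C) (f : hom a b), F2 (id2 f) = id2 (F1 a b f);
  F2_vcomp : forall (a b : C) (f g h : hom a b) (x : cell f g) (y : cell g h),
    F2 (vcomp x y) = vcomp (F2 x) (F2 y);
  Fcomp : forall (a b c : C) (f : hom a b) (g : hom b c),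
    cell (comp1 (F1 a b f) (F1 b c g)) (F1 a c (comp1 f g));
  Fid : forall a : C, cell (id1 (F0 a)) (F1 a a (id1 a));
  Fcomp_inv : forall (a b c : C) (f : hom a b) (g : hom b c),
    invertible (Fcomp f g);
  Fid_inv : forall a : C, invertible (Fid a);
  Fcomp_nat : forall (a b c : C) (f f' : hom a b) (g g' : hom b c)
    (x : cell f f') (y : cell g g'),
    vcomp (hcomp (F2 x) (F2 y)) (Fcomp f' g')
    = vcomp (Fcomp f g) (F2 (hcomp x y));
  Fassoc : forall (a b c d : C) (f : hom a b) (g : hom b c) (h : hom c d),
    vcomp (vcomp (hcomp (Fcomp f g) (id2 (F1 c d h))) (Fcomp (comp1 f g) h))
          (F2 (assoc f g h))
    = vcomp (vcomp (assoc (F1 a b f) (F1 b c g) (F1 c d h))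
                   (hcomp (id2 (F1 a b f)) (Fcomp g h)))
            (Fcomp f (comp1 g h));
  Flunit : forall (a b : C) (f : hom a b),
    vcomp (vcomp (hcomp (Fid a) (id2 (F1 a b f))) (Fcomp (id1 a) f))
          (F2 (lunit f))
    = lunit (F1 a b f);
  Frunit : forall (a b : C) (f : hom a b),
    vcomp (vcomp (hcomp (id2 (F1 a b f)) (Fid b)) (Fcomp f (id1 b)))
          (F2 (runit f))
    = runit (F1 a b f) }.

Arguments F2 {C D F0 F1} _ {a b f g}.

Record span (A B : Type) := Span {
  apex :> Type;
  legl : apex -> A;
  legr : apex -> B }.

Arguments legl {A B}.
Arguments legr {A B}.

Record span_cell (A B : Type) (S S' : span A B) := SpanCell {
  span_map :> apex S -> apex S';
  span_mapl : forall x, legl S' (span_map x) = legl S x;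
  span_mapr : forall x, legr S' (span_map x) = legr S x }.

Lemma span_cell_eq A B (S S' : span A B) (u v : span_cell S S') :
  (forall x, u x = v x) -> u = v.
Proof.
case: u v => [u ul ur] [v vl vr] /= uv.
have E : u = v by apply: funext.
case: v / E vl vr {uv} => vl vr.
by rewrite (Prop_irrelevance ul vl) (Prop_irrelevance ur vr).
Qed.

Definition span_id1 (A : Type) : span A A := @Span A A A id id.

Definition pullback (A B C : Type) (S : span A B) (S' : span B C) : Type :=
  {p : S * S' | legr S p.1 = legl S' p.2}.

Definition span_comp1 (A B C : Type) (S : span A B) (S' : span B C) : span A C :=
  @Span A C (pullback S S')
    (fun p => legl S (sval p).1) (fun p => legr S' (sval p).2).

Lemma pullback_eq A B C (S : span A B) (S' : span B C) (p q : pullback S S') :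
  sval p = sval q -> p = q.
Proof.
case: p q => [p pP] [q qP] /= E; case: q / E in qP *.
by rewrite (Prop_irrelevance pP qP).
Qed.

Definition span_id2 (A B : Type) (S : span A B) : span_cell S S :=
  @SpanCell A B S S id (fun _ => erefl) (fun _ => erefl).

Program Definition span_vcomp (A B : Type) (S S' S'' : span A B)
    (u : span_cell S S') (v : span_cell S' S'') : span_cell S S'' :=
  @SpanCell A B S S'' (fun x => v (u x)) _ _.
Next Obligation. by move=> *; rewrite !span_mapl. Qed.
Next Obligation. by move=> *; rewrite !span_mapr. Qed.

Program Definition span_hcomp (A B C : Type) (S T : span A B) (S' T' : span B C)
    (u : span_cell S T) (v : span_cell S' T') :
    span_cell (span_comp1 S S') (span_comp1 T T') :=
  @SpanCell A C (span_comp1 S S') (span_comp1 T T')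
    (fun p => exist _ (u (sval p).1, v (sval p).2) _) _ _.
Next Obligation.
by move=> A B C S T S' T' u v [[x y] /= xy]; rewrite span_mapl span_mapr.
Qed.
Next Obligation. by move=> *; rewrite /= span_mapl. Qed.
Next Obligation. by move=> *; rewrite /= span_mapr. Qed.

Program Definition span_assoc (A B C D : Type)
    (S : span A B) (T : span B C) (U : span C D) :
    span_cell (span_comp1 (span_comp1 S T) U) (span_comp1 S (span_comp1 T U)) :=
  @SpanCell A D _ _
    (fun p => exist _ ((sval (sval p).1).1,
                       exist _ ((sval (sval p).1).2, (sval p).2) _) _) _ _.
Next Obligation. by move=> A B C D S T U [[[[x y] /= xy] z] /= yz]. Qed.
Next Obligation. by move=> A B C D S T U [[[[x y] /= xy] z] /= yz]. Qed.
Next Obligation. by []. Qed.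
Next Obligation. by []. Qed.

Program Definition span_assocV (A B C D : Type)
    (S : span A B) (T : span B C) (U : span C D) :
    span_cell (span_comp1 S (span_comp1 T U)) (span_comp1 (span_comp1 S T) U) :=
  @SpanCell A D _ _
    (fun p => exist _ (exist _ ((sval p).1, (sval (sval p).2).1) _,
                       (sval (sval p).2).2) _) _ _.
Next Obligation. by move=> A B C D S T U [[x [[y z] /= yz]] /= xy]. Qed.
Next Obligation. by move=> A B C D S T U [[x [[y z] /= yz]] /= xy]. Qed.
Next Obligation. by []. Qed.
Next Obligation. by []. Qed.

Program Definition span_lunit (A B : Type) (S : span A B) :
    span_cell (span_comp1 (span_id1 A) S) S :=
  @SpanCell A B _ _ (fun p => (sval p).2) _ _.
Next Obligation. by move=> A B S [[x y] /= xy]. Qed.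
Next Obligation. by []. Qed.

Program Definition span_lunitV (A B : Type) (S : span A B) :
    span_cell S (span_comp1 (span_id1 A) S) :=
  @SpanCell A B _ _ (fun x => exist _ (legl S x, x) _) _ _.
Next Obligation. by []. Qed.
Next Obligation. by []. Qed.
Next Obligation. by []. Qed.

Program Definition span_runit (A B : Type) (S : span A B) :
    span_cell (span_comp1 S (span_id1 B)) S :=
  @SpanCell A B _ _ (fun p => (sval p).1) _ _.
Next Obligation. by []. Qed.
Next Obligation. by move=> A B S [[x y] /= xy]. Qed.

Program Definition span_runitV (A B : Type) (S : span A B) :
    span_cell S (span_comp1 S (span_id1 B)) :=
  @SpanCell A B _ _ (fun x => exist _ (x, legr S x) _) _ _.
Next Obligation. by []. Qed.
Next Obligation. by []. Qed.
Next Obligation. by []. Qed.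

Definition span_data : bicat_data :=
  @BicatData Type span span_cell span_id1 span_comp1 span_id2 span_vcomp
    span_hcomp span_assoc span_lunit span_runit.

Program Definition SpanSet : bicategory :=
  @Bicategory span_data _ _ _ _ _ _ _ _ _ _ _ _ _.
Next Obligation. by move=> *; apply: span_cell_eq. Qed.
Next Obligation. by move=> *; apply: span_cell_eq. Qed.
Next Obligation. by move=> *; apply: span_cell_eq. Qed.
Next Obligation.
by move=> *; apply: span_cell_eq => -[[x y] xy]; apply: pullback_eq.
Qed.
Next Obligation.
by move=> *; apply: span_cell_eq => -[[x y] xy]; apply: pullback_eq.
Qed.
Next Obligation.
move=> A B C D S T U; exists (span_assocV S T U).
split; apply: span_cell_eq.
- move=> [[[[x y] xy] z] yz]; apply: pullback_eq => /=.
  by congr pair; apply: pullback_eq.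
- move=> [[x [[y z] yz]] xy]; apply: pullback_eq => /=.
  by congr pair; apply: pullback_eq.
Qed.
Next Obligation.
move=> A B S; exists (span_lunitV S); split; apply: span_cell_eq => //.
by move=> [[x y] /= xy]; apply: pullback_eq; rewrite /= xy.
Qed.
Next Obligation.
move=> A B S; exists (span_runitV S); split; apply: span_cell_eq => //.
by move=> [[x y] /= xy]; apply: pullback_eq; rewrite /= xy.
Qed.
Next Obligation.
move=> *; apply: span_cell_eq => -[[[[x y] xy] z] yz]; apply: pullback_eq => /=.
by congr pair; apply: pullback_eq.
Qed.
Next Obligation. by move=> *; apply: span_cell_eq. Qed.
Next Obligation. by move=> *; apply: span_cell_eq. Qed.
Next Obligation.
by move=> *; apply: span_cell_eq => -[[[[x y] xy] z] yz]; apply: pullback_eq.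
Qed.
Next Obligation.
move=> *; apply: span_cell_eq => -[[[[[[x y] xy] z] yz] t] zt].
apply: pullback_eq => /=; congr pair; apply: pullback_eq => /=.
by congr pair; apply: pullback_eq.
Qed.

(* [Cross true] is the right-handed crossing, whose over-strand runs from bottom
   left to top right; [Cross false] is the left-handed one, whose over-strand runs
   from bottom right to top left. *)
Inductive gen := Cross of bool | Cup | Cap.

Definition gdom (g : gen) : nat :=
  match g with Cross _ => 2 | Cup => 0 | Cap => 2 end.
Definition gcod (g : gen) : nat :=
  match g with Cross _ => 2 | Cup => 2 | Cap => 0 end.

(* The layer [(a, g, b)] stands for I_a (x) g (x) I_b, and a word, i.e. a
   sequence of layers read from bottom to top, for their composite.  Every
   composite of tensor products of generators is brought to this form by
     f (x) f' = (f (x) I) o (I (x) f'),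
   and words then satisfy on the nose all the axioms of a strict monoidal
   category except the interchange law
     (f (x) I) o (I (x) f') = (I (x) f') o (f (x) I).
   The latter is an invertible 2-morphism here (the moves [Exch] below), as in
   Gray monoids, i.e. semistrict monoidal 2-categories.  It cannot be imposed
   as an equation: by Eckmann-Hilton, scalars 0 -> 0 would commute and, for a
   move m : d => e between closed diagrams, the 2-morphisms m (x) 1_d and
   1_d (x) m would coincide, although they move distinct components and hence
   act differently on colorings. *)
Definition layer : Type := nat * gen * nat.
Notation word := (seq layer).

Fixpoint typed (m : nat) (w : word) (n : nat) : bool :=
  if w is (a, g, b) :: w' then
    (m == a + gdom g + b) && typed (a + gcod g + b) w' n
  else m == n.

(* A diagram with m endpoints on the bottom and n on the top. *)
Record tangle (m n : nat) := Tangle {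
  tword :> word;
  tangle_typed : typed m tword n }.

(* I_a (x) w (x) I_b *)
Definition pad_layer (a b : nat) (l : layer) : layer :=
  let: (c, g, d) := l in (a + c, g, d + b).
Definition pad (a b : nat) (w : word) : word := map (pad_layer a b) w.

Lemma tangle_eq m n (f g : tangle m n) : f = g :> word -> f = g.
Proof.
case: f g => [f fP] [g gP] /= E; case: g / E in gP *.
by rewrite (Prop_irrelevance fP gP).
Qed.

Lemma typed_cat m u k v n : typed m u k -> typed k v n -> typed m (u ++ v) n.
Proof.
by elim: u m => [m /eqP-> //|[[a g] b] u IH m /= /andP[-> /IH]]; apply.
Qed.

Lemma typed_pad a b m w n : typed m w n ->
  typed (a + m + b) (pad a b w) (a + n + b).
Proof.
elim: w m => [m /eqP-> //=|[[c g] d] w IH m /= /andP[/eqP-> /IH]].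
by rewrite !addnA eqxx /= -!addnA; apply.
Qed.

Definition tangle_id (n : nat) : tangle n n := @Tangle n n [::] (eqxx n).

Definition tangle_comp (m k n : nat) (f : tangle m k) (g : tangle k n) :
    tangle m n :=
  Tangle (typed_cat (tangle_typed f) (tangle_typed g)).

Inductive move :=
| T0l | T0r            (* both sides of T_0 being I_1, there are two moves *)
| T0' of bool
| T1 of bool
| T2 of bool
| T3
| Exch of gen & nat & gen.

Definition mdom (r : move) : nat :=
  match r with
  | T0l | T0r | T0' _ => 1
  | T1 _ => 0
  | T2 _ => 2
  | T3 => 3
  | Exch g c h => gdom g + c + gdom h
  end.

Definition mcod (r : move) : nat :=
  match r with
  | T0l | T0r => 1
  | T0' _ => 3
  | T1 _ => 2
  | T2 _ => 2
  | T3 => 3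
  | Exch g c h => gcod g + c + gcod h
  end.

Definition mlhs (r : move) : word :=
  match r with
  | T0l => [:: (0, Cup, 1); (1, Cap, 0)]
  | T0r => [:: (1, Cup, 0); (0, Cap, 1)]
  | T0' s => [:: (1, Cup, 0); (0, Cross s, 1)]
  | T1 s => [:: (0, Cup, 0); (0, Cross s, 0)]
  | T2 s => [:: (0, Cross s, 0); (0, Cross (~~ s), 0)]
  | T3 => [:: (0, Cross true, 1); (1, Cross true, 0); (0, Cross true, 1)]
  | Exch g c h => [:: (0, g, c + gdom h); (gcod g + c, h, 0)]
  end.

Definition mrhs (r : move) : word :=
  match r with
  | T0l | T0r => [::]
  | T0' s => [:: (0, Cup, 1); (1, Cross (~~ s), 0)]
  | T1 _ => [:: (0, Cup, 0)]
  | T2 _ => [::]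
  | T3 => [:: (1, Cross true, 0); (0, Cross true, 1); (1, Cross true, 0)]
  | Exch g c h => [:: (gdom g + c, h, 0); (0, g, c + gcod h)]
  end.

(* A move r, or its inverse if [sdir] is false, performed inside a disk:
   it replaces u o (I_a (x) r (x) I_b) o v, where u, v are the parts of the
   diagram below and above the disk, and a, b the numbers of strands passing to
   the left and to the right of it. *)
Record step := Step {
  sbelow : word;
  sleft : nat;
  smove : move;
  sdir : bool;
  sright : nat;
  sabove : word }.

Definition sin (s : step) : word :=
  if sdir s then mlhs (smove s) else mrhs (smove s).
Definition sout (s : step) : word :=
  if sdir s then mrhs (smove s) else mlhs (smove s).

Definition ssrc (s : step) : word :=
  sbelow s ++ pad (sleft s) (sright s) (sin s) ++ sabove s.
Definition stgt (s : step) : word :=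
  sbelow s ++ pad (sleft s) (sright s) (sout s) ++ sabove s.

Definition step_typed (m n : nat) (s : step) : bool :=
  typed m (sbelow s) (sleft s + mdom (smove s) + sright s)
  && typed (sleft s + mcod (smove s) + sright s) (sabove s) n.

Definition sinv (s : step) : step :=
  Step (sbelow s) (sleft s) (smove s) (~~ sdir s) (sright s) (sabove s).

Definition vwhisk (u v : word) (s : step) : step :=
  Step (u ++ sbelow s) (sleft s) (smove s) (sdir s) (sright s) (sabove s ++ v).

Definition hwhisk (a b : nat) (s : step) : step :=
  Step (pad a b (sbelow s)) (a + sleft s) (smove s) (sdir s) (sright s + b)
       (pad a b (sabove s)).

Lemma move_typed r : typed (mdom r) (mlhs r) (mcod r)
  /\ typed (mdom r) (mrhs r) (mcod r).
Proof.
case: r => [||[]|[]|[]||g c h] //=.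
by rewrite !addn0 add0n !addnA !eqxx.
Qed.

Lemma sin_typed s : typed (mdom (smove s)) (sin s) (mcod (smove s)).
Proof. by rewrite /sin; case: (move_typed (smove s)); case: sdir. Qed.

Lemma sout_typed s : typed (mdom (smove s)) (sout s) (mcod (smove s)).
Proof. by rewrite /sout; case: (move_typed (smove s)); case: sdir. Qed.

Lemma ssrc_typed m n s : step_typed m n s -> typed m (ssrc s) n.
Proof.
move=> /andP[h1 h2]; apply: typed_cat h1 (typed_cat _ h2).
exact: typed_pad (sin_typed s).
Qed.

Lemma stgt_typed m n s : step_typed m n s -> typed m (stgt s) n.
Proof.
move=> /andP[h1 h2]; apply: typed_cat h1 (typed_cat _ h2).
exact: typed_pad (sout_typed s).
Qed.

Record disk_move (m n : nat) := DiskMove {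
  dm_step :> step;
  dm_typed : step_typed m n dm_step }.

Definition dm_src m n (s : disk_move m n) : tangle m n :=
  Tangle (ssrc_typed (dm_typed s)).
Definition dm_tgt m n (s : disk_move m n) : tangle m n :=
  Tangle (stgt_typed (dm_typed s)).

(* Every vertical or horizontal composite or tensor product of local moves is a
   vertical composite of local moves in disks; so a 2-morphism is represented
   by a sequence of these. *)
Fixpoint chain (m n : nat) (f : word) (p : seq step) (g : word) : Prop :=
  if p is s :: p' then [/\ f = ssrc s, step_typed m n s & chain m n (stgt s) p' g]
  else f = g.

Record movie (m n : nat) (f g : tangle m n) := Movie {
  frames :> seq step;
  movie_chain : chain m n f frames g }.

(* The interchangers, as sequences of [Exch] moves:
   slide_right h w : (w (x) I_{dom h}) o (I (x) h) => (I (x) h) o (w (x) I_{cod h})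
   slide_left h w : (h (x) I) o (I_{cod h} (x) w) => (I_{dom h} (x) w) o (h (x) I) *)
Fixpoint slide_right (h : gen) (w : word) : seq step :=
  if w is (a, g, b) :: w' then
    map (vwhisk [:: (a, g, b + gdom h)] [::]) (slide_right h w')
    ++ [:: Step [::] a (Exch g b h) true 0 (pad 0 (gcod h) w')]
  else [::].

Fixpoint slide_left (h : gen) (w : word) : seq step :=
  if w is (a, g, b) :: w' then
    Step [::] 0 (Exch h a g) true b (pad (gcod h) 0 w')
    :: map (vwhisk [:: (gdom h + a, g, b)] [::]) (slide_left h w')
  else [::].

(* The defining relations of the free semistrict monoidal 2-category: moves are
   invertible; moves at distinct heights commute (interchange of horizontal and
   vertical composition); interchangers are natural in both arguments. *)
Inductive movie_rel : seq step -> seq step -> Prop :=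
| rel_inv s : movie_rel [:: s; sinv s] [::]
| rel_commute s s' :
    movie_rel [:: vwhisk [::] (ssrc s') s; vwhisk (stgt s) [::] s']
              [:: vwhisk (ssrc s) [::] s'; vwhisk [::] (stgt s') s]
| rel_slide_right m n s h : step_typed m n s ->
    movie_rel (vwhisk [::] [:: (n, h, 0)] (hwhisk 0 (gdom h) s)
                 :: slide_right h (stgt s))
              (rcons (slide_right h (ssrc s))
                 (vwhisk [:: (m, h, 0)] [::] (hwhisk 0 (gcod h) s)))
| rel_slide_left m n s h : step_typed m n s ->
    movie_rel (vwhisk [:: (0, h, m)] [::] (hwhisk (gcod h) 0 s)
                 :: slide_left h (stgt s))
              (rcons (slide_left h (ssrc s))
                 (vwhisk [::] [:: (0, h, n)] (hwhisk (gdom h) 0 s))).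

(* One application of a relation inside a movie. *)
Inductive movie_step (m n : nat) (f g : tangle m n) :
    movie f g -> movie f g -> Prop :=
| MovieStep (P Q : movie f g) p q u v a b l r of movie_rel l r
    & frames P = p ++ map (vwhisk u v \o hwhisk a b) l ++ q
    & frames Q = p ++ map (vwhisk u v \o hwhisk a b) r ++ q :
    movie_step P Q.

Definition tang_cell (m n : nat) (f g : tangle m n) : Type :=
  quot (@movie_step m n f g).

Lemma movie_eq m n (f g : tangle m n) (P Q : movie f g) :
  frames P = frames Q -> P = Q.
Proof.
case: P Q => [p pP] [q qP] /= E; case: q / E in qP *.
by rewrite (Prop_irrelevance pP qP).
Qed.

Lemma chain_cat m n f p g q h :
  chain m n f p g -> chain m n g q h -> chain m n f (p ++ q) h.
Proof.
elim: p f => [f -> //|s p IH f /= [-> s_ok pg] qh].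
by split=> //; apply: IH.
Qed.

Lemma ssrc_vwhisk u v s : ssrc (vwhisk u v s) = u ++ ssrc s ++ v.
Proof. by rewrite /ssrc /= -!catA. Qed.

Lemma stgt_vwhisk u v s : stgt (vwhisk u v s) = u ++ stgt s ++ v.
Proof. by rewrite /stgt /= -!catA. Qed.

Lemma vwhisk_comp u v u' v' s :
  vwhisk u v (vwhisk u' v' s) = vwhisk (u ++ u') (v' ++ v) s.
Proof. by rewrite /vwhisk /= !catA. Qed.

Lemma vwhisk_nil s : vwhisk [::] [::] s = s.
Proof. by case: s => *; rewrite /vwhisk /= cats0. Qed.

Lemma pad00 w : pad 0 0 w = w.
Proof. by elim: w => [|[[a g] b] w IH] //=; rewrite addn0 IH. Qed.

Lemma hwhisk00 s : hwhisk 0 0 s = s.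
Proof. by case: s => *; rewrite /hwhisk /= !pad00 addn0. Qed.

Lemma step_typed_vwhisk k m n l u v s :
  typed k u m -> typed n v l -> step_typed m n s ->
  step_typed k l (vwhisk u v s).
Proof.
move=> hu hv /andP[h1 h2]; apply/andP; split => /=; first exact: typed_cat h1.
exact: typed_cat hv.
Qed.

Lemma chain_vwhisk k m n l u v f p g : typed k u m -> typed n v l ->
  chain m n f p g ->
  chain k l (u ++ f ++ v) (map (vwhisk u v) p) (u ++ g ++ v).
Proof.
move=> hu hv; elim: p f => [f -> //|s p IH f /= [-> s_ok pg]].
by rewrite ssrc_vwhisk stgt_vwhisk; split=> //;
  [apply: step_typed_vwhisk s_ok | apply: IH].
Qed.

Definition movie_nil m n (f g : tangle m n) (fg : f = g :> word) : movie f g :=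
  @Movie m n f g [::] fg.

Definition movie_cat m n (f g h : tangle m n) (P : movie f g) (Q : movie g h) :
    movie f h :=
  Movie (chain_cat (movie_chain P) (movie_chain Q)).

Lemma chain_wl k m n (u : tangle k m) (f g : tangle m n) (P : movie f g) :
  chain k n (u ++ f) (map (vwhisk u [::]) P) (u ++ g).
Proof.
rewrite -[X in u ++ X]cats0 -[X in chain _ _ _ _ (u ++ X)]cats0.
by apply: chain_vwhisk (tangle_typed u) _ (movie_chain P); apply: eqxx.
Qed.

Lemma chain_wr m n l (f g : tangle m n) (P : movie f g) (v : tangle n l) :
  chain m l (f ++ v) (map (vwhisk [::] v) P) (g ++ v).
Proof.
by apply: (@chain_vwhisk m m n l [::] v) (movie_chain P);
  [apply: eqxx | apply: tangle_typed].
Qed.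

Definition movie_wl k m n (u : tangle k m) (f g : tangle m n) (P : movie f g) :
    movie (tangle_comp u f) (tangle_comp u g) :=
  @Movie k n (tangle_comp u f) (tangle_comp u g) _ (chain_wl u P).

Definition movie_wr m n l (f g : tangle m n) (P : movie f g) (v : tangle n l) :
    movie (tangle_comp f v) (tangle_comp g v) :=
  @Movie m l (tangle_comp f v) (tangle_comp g v) _ (chain_wr P v).

Definition movie_hcomp m k n (f g : tangle m k) (f' g' : tangle k n)
    (P : movie f g) (P' : movie f' g') :
    movie (tangle_comp f f') (tangle_comp g g') :=
  movie_cat (movie_wr P f') (movie_wl g P').

Notation "P ~m Q" := (eclass (@movie_step _ _ _ _) P Q) (at level 70).

Lemma eclass_map T T' (R : T -> T -> Prop) (R' : T' -> T' -> Prop) (F : T -> T') :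
  (forall x y, R x y -> R' (F x) (F y)) ->
  forall x y, eclass R x y -> eclass R' (F x) (F y).
Proof.
move=> RF x y; elim=> [{}x {}y /RF|{}x|{}x {}y _|{}x {}y z _ xy _ yz].
- exact: rst_step.
- exact: rst_refl.
- exact: rst_sym.
- exact: rst_trans xy yz.
Qed.

Lemma cat_movie_step m n (f g h : tangle m n) (P P' : movie f g)
    (Q Q' : movie g h) :
  P ~m P' -> Q ~m Q' -> movie_cat P Q ~m movie_cat P' Q'.
Proof.
move=> PP' QQ'; apply: (@rst_trans _ _ _ (movie_cat P' Q)).
- apply: (eclass_map (F := fun P => movie_cat P Q)) PP' => {P P' QQ'}.
  move=> _ _ [P P' p q u v a b l r lr eP eP'].
  by apply: (@MovieStep _ _ _ _ _ _ p (q ++ Q) u v a b l r) => //=;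
    rewrite ?eP ?eP' -!catA.
- apply: (eclass_map (F := fun Q => movie_cat P' Q)) QQ' => {Q Q' PP'}.
  move=> _ _ [Q Q' p q u v a b l r lr eQ eQ'].
  by apply: (@MovieStep _ _ _ _ _ _ (P' ++ p) q u v a b l r) => //=;
    rewrite ?eQ ?eQ' -!catA.
Qed.

Lemma map_vwhisk_comp u v u' v' a b (l : seq step) :
  map (vwhisk u v) (map (vwhisk u' v' \o hwhisk a b) l)
  = map (vwhisk (u ++ u') (v' ++ v) \o hwhisk a b) l.
Proof. by rewrite -map_comp; apply: eq_map => s /=; rewrite vwhisk_comp. Qed.

Lemma wl_movie_step k m n (u : tangle k m) (f g : tangle m n)
    (P P' : movie f g) :
  P ~m P' -> movie_wl u P ~m movie_wl u P'.
Proof.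
move=> PP'; apply: (eclass_map (F := fun P => movie_wl u P)) PP' => {P P'}.
move=> _ _ [P P' p q u' v a b l r lr eP eP'].
apply: (@MovieStep _ _ _ _ _ _ (map (vwhisk u [::]) p) (map (vwhisk u [::]) q)
  (u ++ u') (v ++ [::]) a b l r) => //=.
- by rewrite eP !map_cat map_vwhisk_comp.
- by rewrite eP' !map_cat map_vwhisk_comp.
Qed.

Lemma wr_movie_step m n l (f g : tangle m n) (v : tangle n l)
    (P P' : movie f g) :
  P ~m P' -> movie_wr P v ~m movie_wr P' v.
Proof.
move=> PP'; apply: (eclass_map (F := fun P => movie_wr P v)) PP' => {P P'}.
move=> _ _ [P P' p q u v' a b s r sr eP eP'].
apply: (@MovieStep _ _ _ _ _ _ (map (vwhisk [::] v) p) (map (vwhisk [::] v) q)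
  u (v' ++ v) a b s r) => //=.
- by rewrite eP !map_cat map_vwhisk_comp.
- by rewrite eP' !map_cat map_vwhisk_comp.
Qed.

Lemma hcomp_movie_step m k n (f g : tangle m k) (f' g' : tangle k n)
    (P Q : movie f g) (P' Q' : movie f' g') :
  P ~m Q -> P' ~m Q' -> movie_hcomp P P' ~m movie_hcomp Q Q'.
Proof.
by move=> PQ PQ'; apply: cat_movie_step;
  [apply: wr_movie_step | apply: wl_movie_step].
Qed.

Definition tang_id2 m n (f : tangle m n) : tang_cell f f :=
  qpi _ (movie_nil (erefl (tword f))).

Definition tang_vcomp m n (f g h : tangle m n)
    (x : tang_cell f g) (y : tang_cell g h) : tang_cell f h :=
  qpi _ (movie_cat (qrepr x) (qrepr y)).

Definition tang_hcomp m k n (f g : tangle m k) (f' g' : tangle k n)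
    (x : tang_cell f g) (x' : tang_cell f' g') :
    tang_cell (tangle_comp f f') (tangle_comp g g') :=
  qpi _ (movie_hcomp (qrepr x) (qrepr x')).

(* Composition of diagrams is strictly associative and unital. *)
Definition tang_assoc m k l n (f : tangle m k) (g : tangle k l)
    (h : tangle l n) :
    tang_cell (tangle_comp (tangle_comp f g) h)
              (tangle_comp f (tangle_comp g h)) :=
  qpi _ (movie_nil (esym (catA f g h)
    : tangle_comp (tangle_comp f g) h = tangle_comp f (tangle_comp g h) :> word)).

Definition tang_lunit m n (f : tangle m n) :
    tang_cell (tangle_comp (tangle_id m) f) f :=
  qpi _ (movie_nil (cat0s f : tangle_comp (tangle_id m) f = f :> word)).

Definition tang_runit m n (f : tangle m n) :
    tang_cell (tangle_comp f (tangle_id n)) f :=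
  qpi _ (movie_nil (cats0 f : tangle_comp f (tangle_id n) = f :> word)).

Lemma tang_vcompE m n (f g h : tangle m n) (P : movie f g) (Q : movie g h) :
  tang_vcomp (qpi _ P) (qpi _ Q) = qpi _ (movie_cat P Q).
Proof. by apply: eq_qpi; apply: cat_movie_step; apply: qreprP. Qed.

Lemma tang_hcompE m k n (f g : tangle m k) (f' g' : tangle k n)
    (P : movie f g) (P' : movie f' g') :
  tang_hcomp (qpi _ P) (qpi _ P') = qpi _ (movie_hcomp P P').
Proof. by apply: eq_qpi; apply: hcomp_movie_step; apply: qreprP. Qed.

Lemma commute_step m k n (s : disk_move m k) (f g : tangle k n) (Q : movie f g)
    (P1 P2 : movie (tangle_comp (dm_src s) f) (tangle_comp (dm_tgt s) g)) :
  frames P1 = vwhisk [::] f s :: map (vwhisk (stgt s) [::]) Q ->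
  frames P2 = rcons (map (vwhisk (ssrc s) [::]) Q) (vwhisk [::] g s) ->
  P1 ~m P2.
Proof.
case: Q => q; elim: q f P1 P2 => [|t q IH] f P1 P2 qP /= E1 E2.
  have -> : P1 = P2 by apply: movie_eq; rewrite E1 E2 qP.
  exact: rst_refl.
case: (qP) => ft t_ok qg.
pose t' := DiskMove t_ok.
have ? : f = dm_src t' by apply: tangle_eq.
subst f; rewrite /= in E1 E2.
pose Q' := @Movie k n (dm_tgt t') g q qg.
have c2 : chain m n (ssrc s ++ stgt t)
    (rcons (map (vwhisk (ssrc s) [::]) q) (vwhisk [::] g s)) (stgt s ++ g).
  rewrite -cats1; apply: chain_cat (chain_wl (dm_src s) Q') _.
  have c : chain m k (dm_src s) [:: dm_step s] (dm_tgt s).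
    by split=> //; apply: dm_typed.
  exact: (chain_wr (Movie c) g).
have c1 : chain m n (ssrc s ++ stgt t)
    (vwhisk [::] (stgt t) s :: map (vwhisk (stgt s) [::]) q) (stgt s ++ g).
  rewrite -cat1s; apply: chain_cat (chain_wl (dm_tgt s) Q').
  have c : chain m k (dm_src s) [:: dm_step s] (dm_tgt s).
    by split=> //; apply: dm_typed.
  exact: (chain_wr (Movie c) (dm_tgt t')).
pose M1 := @Movie m n (tangle_comp (dm_src s) (dm_tgt t'))
  (tangle_comp (dm_tgt s) g) _ c1.
pose M2 := @Movie m n (tangle_comp (dm_src s) (dm_tgt t'))
  (tangle_comp (dm_tgt s) g) _ c2.
have ct : chain k n (dm_src t') [:: t] (dm_tgt t') by [].
pose H := movie_wl (dm_src s) (Movie ct).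
have M12 : M1 ~m M2 by apply: (IH (dm_tgt t') M1 M2 qg).
apply: (@rst_trans _ _ _ (movie_cat H M1)).
  apply: rst_step.
  apply: (@MovieStep _ _ _ _ _ _ [::] (map (vwhisk (stgt s) [::]) q)
    [::] [::] 0 0 _ _ (rel_commute s t)) => /=.
  - by rewrite E1 !vwhisk_nil !hwhisk00.
  - by rewrite !vwhisk_nil !hwhisk00.
have -> : P2 = movie_cat H M2 by apply: movie_eq.
by apply: cat_movie_step M12; apply: rst_refl.
Qed.

Lemma commute_movies m k n (f g : tangle m k) (f' g' : tangle k n)
    (P : movie f g) (Q : movie f' g') :
  movie_cat (movie_wr P f') (movie_wl g Q)
  ~m movie_cat (movie_wl f Q) (movie_wr P g').
Proof.
case: P => p; elim: p f => [|s p IH] f pP.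
  have ? : f = g by apply: tangle_eq.
  subst f; set A := movie_cat _ _; set B := movie_cat _ _.
  have -> : A = B by apply: movie_eq; rewrite /= cats0.
  exact: rst_refl.
case: (pP) => fs s_ok pg; pose s' := DiskMove s_ok.
have ? : f = dm_src s' by apply: tangle_eq.
subst f; pose P' := @Movie m k (dm_tgt s') g p pg.
have cs : chain m k (dm_src s') [:: s] (dm_tgt s') by [].
pose S := Movie cs.
apply: (@rst_trans _ _ _ (movie_cat (movie_wr S f')
   (movie_cat (movie_wr P' f') (movie_wl g Q)))).
  set A := movie_cat _ _; set B := movie_cat _ _.
  have -> : A = B by apply: movie_eq.
  exact: rst_refl.
apply: (@rst_trans _ _ _ (movie_cat (movie_wr S f')
   (movie_cat (movie_wl (dm_tgt s') Q) (movie_wr P' g')))).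
  by apply: cat_movie_step; [apply: rst_refl | apply: IH].
apply: (@rst_trans _ _ _ (movie_cat
   (movie_cat (movie_wr S f') (movie_wl (dm_tgt s') Q)) (movie_wr P' g'))).
  set A := movie_cat _ _; set B := movie_cat _ _.
  have -> : A = B by apply: movie_eq; rewrite /= -?catA.
  exact: rst_refl.
apply: (@rst_trans _ _ _ (movie_cat
   (movie_cat (movie_wl (dm_src s') Q) (movie_wr S g')) (movie_wr P' g'))).
  apply: cat_movie_step; last exact: rst_refl.
  by apply: (commute_step (s := s') (Q := Q)); rewrite //= cats1.
set A := movie_cat _ _; set B := movie_cat _ _.
have -> : A = B by apply: movie_eq; rewrite /= -catA.
exact: rst_refl.
Qed.

Definition tang_data : bicat_data :=
  @BicatData nat tangle tang_cell tangle_id tangle_comp tang_id2 tang_vcomp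
    tang_hcomp tang_assoc tang_lunit tang_runit.

Ltac tang_movies :=
  repeat match goal with x : cell _ _ |- _ =>
    rewrite -(qreprK x); move: (qrepr x) => {x} x end;
  rewrite /= /tang_id2 /tang_assoc /tang_lunit /tang_runit
    ?(tang_vcompE, tang_hcompE).

Lemma eq_qpi_frames m n (f g : tangle m n) (P Q : movie f g) :
  frames P = frames Q -> qpi (@movie_step _ _ f g) P = qpi _ Q.
Proof. by move=> /movie_eq ->. Qed.

Lemma tang_nil_inv m n (f g : tangle m n) (fg : f = g :> word) :
  @invertible tang_data m n f g (qpi _ (movie_nil fg)).
Proof.
exists (qpi _ (movie_nil (esym fg))).
by rewrite /= !tang_vcompE; split; apply: eq_qpi_frames.
Qed.

Lemma map_vwhisk_nil (p : seq step) : map (vwhisk [::] [::]) p = p.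
Proof. by rewrite (eq_map vwhisk_nil) map_id. Qed.

Program Definition Tang : bicategory :=
  @Bicategory tang_data _ _ _ _ _ _ _ _ _ _ _ _ _.
Next Obligation.
by move=> a b f g h k x y z; tang_movies; apply: eq_qpi_frames; rewrite /= catA.
Qed.
Next Obligation. by move=> a b f g x; tang_movies; apply: eq_qpi_frames. Qed.
Next Obligation.
by move=> a b f g x; tang_movies; apply: eq_qpi_frames; rewrite /= cats0.
Qed.
Next Obligation. by move=> a b c f g; tang_movies; apply: eq_qpi_frames. Qed.
Next Obligation.
move=> a b c f g h f' g' h' x y x' y'; tang_movies.
apply: eq_qpi; rewrite /movie_hcomp.
set A := movie_cat _ _; set B := movie_cat _ _.
have -> : A = movie_cat (movie_wr x f') (movie_cat
    (movie_cat (movie_wr y f') (movie_wl h x')) (movie_wl h y')).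
  by apply: movie_eq; rewrite /= !map_cat -!catA.
have -> : B = movie_cat (movie_wr x f') (movie_cat
    (movie_cat (movie_wl g x') (movie_wr y g')) (movie_wl h y')).
  by apply: movie_eq; rewrite /= -!catA.
apply: cat_movie_step; first exact: rst_refl.
by apply: cat_movie_step; [apply: commute_movies | apply: rst_refl].
Qed.
Next Obligation. by move=> *; apply: tang_nil_inv. Qed.
Next Obligation. by move=> *; apply: tang_nil_inv. Qed.
Next Obligation. by move=> *; apply: tang_nil_inv. Qed.
Next Obligation.
move=> a b c d f f' g g' h h' x y z; tang_movies; apply: eq_qpi_frames.
rewrite /= !map_cat -!map_comp cats0 -catA.
by congr (_ ++ (_ ++ _)); apply: eq_map => s /=; rewrite !vwhisk_comp ?cats0.
Qed.
Next Obligation.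
move=> a b f g x; tang_movies; apply: eq_qpi_frames.
by rewrite /= cats0 map_vwhisk_nil.
Qed.
Next Obligation.
move=> a b f g x; tang_movies; apply: eq_qpi_frames.
by rewrite /= !cats0 map_vwhisk_nil.
Qed.
Next Obligation. by move=> *; tang_movies; apply: eq_qpi_frames. Qed.
Next Obligation. by move=> *; tang_movies; apply: eq_qpi_frames. Qed.

(* The diagram of a word is cut by horizontal levels 0, ..., size w, the layer
   number i lying between levels i and i.+1.  The pair (i, j) denotes the j-th
   point, from the left, of the diagram at level i. *)
Definition width (m : nat) (w : word) (i : nat) : nat :=
  if i is i'.+1 then
    if onth w i' is Some (a, g, b) then a + gcod g + b else 0
  else m.

Definition is_point (m : nat) (w : word) (p : nat * nat) : bool :=
  p.2 < width m w p.1.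

Definition point m n (T : tangle m n) : Type := {p | is_point m T p}.

(* The pairs of points joined by a strand inside a single layer, without
   passing under a crossing. *)
Inductive joined (w : word) : nat * nat -> nat * nat -> Prop :=
| joined_left i a g b j :
    onth w i = Some (a, g, b) -> j < a -> joined w (i, j) (i.+1, j)
| joined_right i a g b j :
    onth w i = Some (a, g, b) -> j < b ->
    joined w (i, a + gdom g + j) (i.+1, a + gcod g + j)
| joined_over_right i a b :
    onth w i = Some (a, Cross true, b) -> joined w (i, a) (i.+1, a.+1)
| joined_over_left i a b :
    onth w i = Some (a, Cross false, b) -> joined w (i, a.+1) (i.+1, a)
| joined_cup i a b :
    onth w i = Some (a, Cup, b) -> joined w (i.+1, a) (i.+1, a.+1)
| joined_cap i a b :
    onth w i = Some (a, Cap, b) -> joined w (i, a) (i, a.+1).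

(* [crossing w o u u']: at some crossing, o lies on the over-strand, and u, u'
   are the lower and upper ends of the under-strand. *)
Inductive crossing (w : word) : nat * nat -> nat * nat -> nat * nat -> Prop :=
| crossing_right i a b :
    onth w i = Some (a, Cross true, b) -> crossing w (i, a) (i, a.+1) (i.+1, a)
| crossing_left i a b :
    onth w i = Some (a, Cross false, b) -> crossing w (i, a.+1) (i, a) (i.+1, a.+1).

(* Every arc meets some level, so an arc is a class of points for the
   equivalence relation generated by [joined]. *)
Definition arc m n (T : tangle m n) : Type :=
  quot (fun p q : point T => joined T (val p) (val q)).

Definition arc_of m n (T : tangle m n) (p : point T) : arc T := qpi _ p.

Definition coloring (Q : quandle) m n (T : tangle m n) : Type :=
  {c : arc T -> Q | forall o u u' : point T,
     crossing T (val o) (val u) (val u') ->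
     c (arc_of u') = c (arc_of o) |> c (arc_of u)}.

Lemma width_top m w n : typed m w n -> width m w (size w) = n.
Proof.
elim: w m => [m /eqP|[[a g] b] w IH m /= /andP[_ /IH]] //.
by case: w {IH}.
Qed.

Lemma is_point_bottom m n (T : tangle m n) (j : 'I_m) : is_point m T (0, j : nat).
Proof. exact: ltn_ord. Qed.

Lemma is_point_top m n (T : tangle m n) (j : 'I_n) :
  is_point m T (size T, j : nat).
Proof. by rewrite /is_point /= (width_top (tangle_typed T)). Qed.

Definition bottom_point m n (T : tangle m n) (j : 'I_m) : point T :=
  exist _ (0, j : nat) (is_point_bottom T j).

Definition top_point m n (T : tangle m n) (j : 'I_n) : point T :=
  exist _ (size T, j : nat) (is_point_top T j).

Definition Col_ob (Q : quandle) (n : nat) : Type := n.-tuple Q.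

Definition Col (Q : quandle) m n (T : tangle m n) :
    span (Col_ob Q m) (Col_ob Q n) :=
  @Span (Col_ob Q m) (Col_ob Q n) (coloring Q T)
    (fun c => [tuple sval c (arc_of (bottom_point T j)) | j < m])
    (fun c => [tuple sval c (arc_of (top_point T j)) | j < n]).

(* The color at the point (i, j), or [None] if there is no such point. *)
Definition color_at (Q : quandle) m n (T : tangle m n) (c : coloring Q T)
    (i j : nat) : option Q :=
  if insub (i, j) is Some p then Some (sval c (arc_of (p : point T))) else None.

(* The disk lies between two levels; the strands passing beside it at these
   heights are those which meet the two levels, so that it suffices to compare
   colors below and above the disk. *)
Definition agree_outside (Q : quandle) m n (s : disk_move m n)
    (c : coloring Q (dm_src s)) (c' : coloring Q (dm_tgt s)) : Prop :=
  (forall i j, i <= size (sbelow s) -> color_at c i j = color_at c' i j)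
  /\ (forall i j, color_at c (size (sbelow s) + size (sin s) + i) j
                  = color_at c' (size (sbelow s) + size (sout s) + i) j).

Lemma dm_chain m n (s : disk_move m n) :
  chain m n (dm_src s) [:: dm_step s] (dm_tgt s).
Proof. by split=> //; apply: dm_typed. Qed.

Definition dm_cell m n (s : disk_move m n) :
    @cell Tang m n (dm_src s) (dm_tgt s) :=
  qpi _ (Movie (dm_chain s)).

(* Main.v *)
Require Import Defs.
From mathcomp Require Import all_boot.
From mathcomp Require Import boolp zify.
From Stdlib Require Import Relation_Operators.

Set Implicit Arguments.
Unset Strict Implicit.
Unset Printing Implicit Defensive.

(** Cut a diagram by its horizontal levels and read the colors met along each
    of them. A coloring then becomes the list of colors on the bottom line
    followed by one list of colors per layer, consecutive lists being related
    by the layer between them: a run ([run]). Nothing is lost or added in this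
    translation ([coloring_inj], [coloring_of_run]), because every arc meets a
    level and each coloring condition only involves points around one layer.
    Runs of a composite word are concatenations of runs which agree on the
    middle level, that is, elements of a pullback; this gives the comparison
    cells [Col_glue], and all the coherence laws reduce to the associativity
    and unit laws of concatenation.

    A move in a disk keeps the part of a run below the disk and the part above
    it, and replaces what is inside. There is exactly one replacement with the
    same colors on the boundary ([move_fill_lr], [move_fill_rl],
    [move_lhs_uniq], [move_rhs_uniq]): this is where the quandle enters. T0'
    and T2 use b |> (b |> a) = a, which is what being involutory means; T1 uses
    idempotence and T3 self-distributivity, while T0 and the exchange of two
    generators hold for colors in any set. So a movie acts on runs, and its
    action is the relation [movie_act], which is total and functional.

    The 2-morphisms are classes of movies, so one has to see that the two sides
    of each defining relation act alike, also inside a larger diagram. Since the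
    actions are functional it suffices to find, for each run of the source, one
    common result ([movie_rel_act]). For the interchangers the point is that
    sliding a generator past a diagram w leaves the run of w untouched
    ([slide_right_act], [slide_left_act]), so it makes no difference whether a
    move inside w happens before or after the slide.

    Finally, two colorings agree outside a disk exactly when their runs are
    related by the action of the move ([agree_outsideE]), whence the
    description of the functor on local moves. *)

(** * Runs of a word *)

Section Runs.
Context (X : quandle).
Implicit Types (x y z L R : seq X) (A B C xs ys zs : seq (seq X)).

(** The colors at the lower and at the upper ends of a generator, from left to
    right. At a crossing the under-strand is recolored from bottom to top; for
    an involutory quandle the opposite choice gives the same relation. *)
Inductive gen_rel : gen -> seq X -> seq X -> Prop :=
| gen_rel_right a b : gen_rel (Cross true) [:: a; b] [:: a |> b; a]
| gen_rel_left a b : gen_rel (Cross false) [:: a; b] [:: b; b |> a]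
| gen_rel_cup a : gen_rel Cup [::] [:: a; a]
| gen_rel_cap a : gen_rel Cap [:: a; a] [::].

Definition wrap L R x := L ++ x ++ R.

Inductive layer_rel : layer -> seq X -> seq X -> Prop :=
| LayerRel a g b L R p q :
    size L = a -> size R = b -> gen_rel g p q ->
    layer_rel (a, g, b) (wrap L R p) (wrap L R q).

(** The bottom line [x] is kept apart from the levels [xs] above it: moves change
    [xs], even its length, but never [x]. *)
Fixpoint run x (w : word) xs : Prop :=
  match w, xs with
  | [::], [::] => True
  | l :: w', y :: xs' => layer_rel l x y /\ run y w' xs'
  | _, _ => False
  end.

Lemma gen_rel_size g p q : gen_rel g p q -> size p = gdom g /\ size q = gcod g.
Proof. by case. Qed.

Lemma run_size x w xs : run x w xs -> size xs = size w.
Proof. by elim: w x xs => [|l w IH] x [|y xs] //= [_ /IH->]. Qed.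

Lemma run_cat x u v A B : size A = size u ->
  run x (u ++ v) (A ++ B) <-> run x u A /\ run (last x A) v B.
Proof.
elim: u x A => [|l u IH] x [|y A] //=; first by split=> // -[].
by case=> /(IH y) E; split=> [[? /E[]]|[[? ?] ?]] //; split=> //; apply/E.
Qed.

Lemma run_catE x u v xs : run x (u ++ v) xs <->
  exists A B, [/\ xs = A ++ B, run x u A & run (last x A) v B].
Proof.
split=> [h|[A [B [-> hA hB]]]]; last by apply/(run_cat _ _ _ (run_size hA)).
have s : size (take (size u) xs) = size u.
  by apply/size_takel; rewrite (run_size h) size_cat leq_addr.
exists (take (size u) xs), (drop (size u) xs); rewrite cat_take_drop.
by rewrite -(cat_take_drop (size u) xs) in h; case/(run_cat _ _ _ s): h.
Qed.

Lemma layer_relE a g b x y : layer_rel (a, g, b) x y ->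
  exists L R p q, [/\ size L = a, size R = b, gen_rel g p q,
                      x = wrap L R p & y = wrap L R q].
Proof. by move=> h; inversion h; subst; exists L, R, p, q. Qed.

Lemma layer_rel_size a g b x y : layer_rel (a, g, b) x y ->
  size x = a + gdom g + b /\ size y = a + gcod g + b.
Proof.
move=> /layer_relE[L [R [p [q [sL sR gpq -> ->]]]]].
by have [sp sq] := gen_rel_size gpq; rewrite /wrap !size_cat sp sq sL sR !addnA.
Qed.

Lemma run_typed m w n x xs :
  typed m w n -> size x = m -> run x w xs -> size (last x xs) = n.
Proof.
elim: w m x xs => [|[[a g] b] w IH] m x [|y xs] //=; first by move=> /eqP<-.
by move=> /andP[_ tw] _ [/layer_rel_size[_ sy]]; apply: IH tw sy.
Qed.

Lemma wrap_wrap L R L' R' x :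
  wrap L R (wrap L' R' x) = wrap (L ++ L') (R' ++ R) x.
Proof. by rewrite /wrap -!catA. Qed.

Lemma cat_eq_split (T : Type) (s1 s2 t1 t2 : seq T) :
  size s1 = size s2 -> s1 ++ t1 = s2 ++ t2 -> s1 = s2 /\ t1 = t2.
Proof. by elim: s1 s2 => [|x s1 IH] [|y s2] //= [/IH{}IH] [-> /IH[-> ->]]. Qed.

Lemma layer_rel_wrap L R a g b x y : layer_rel (a, g, b) x y ->
  layer_rel (size L + a, g, b + size R) (wrap L R x) (wrap L R y).
Proof.
move=> /layer_relE[L' [R' [p [q [sL sR gpq -> ->]]]]].
by rewrite !wrap_wrap; constructor; rewrite // size_cat ?sL ?sR.
Qed.

(** A layer of the padded word cannot touch the strands [L] and [R] that pass
    beside it; the size hypothesis places them entirely beside the layer. *)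
Lemma layer_rel_unwrap L R a g b x z : size x = a + gdom g + b ->
  layer_rel (size L + a, g, b + size R) (wrap L R x) z ->
  exists2 y, z = wrap L R y & layer_rel (a, g, b) x y.
Proof.
move=> sx /layer_relE[L' [R' [p [q [sL sR gpq E ->]]]]].
have [sp _] := gen_rel_size gpq.
move: E; rewrite -(cat_take_drop (size L) L') -(cat_take_drop b R') -wrap_wrap.
have sL1 : size (take (size L) L') = size L.
  by rewrite size_takel // sL leq_addr.
have sR1 : size (take b R') = b by rewrite size_takel // sR leq_addr.
set y := wrap _ _ p => /(cat_eq_split (esym sL1)) [EL].
have sxy : size x = size y.
  rewrite sx /y /wrap !size_cat size_drop sL addKn sp sR1; lia.
move=> /(cat_eq_split sxy) [-> ER].
exists (wrap (drop (size L) L') (take b R') q).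
  by rewrite wrap_wrap -EL -ER.
by constructor; rewrite // size_drop sL addKn.
Qed.

Lemma run_wrap L R w x xs :
  run (wrap L R x) (pad (size L) (size R) w) xs <->
  exists2 ys, xs = map (wrap L R) ys & run x w ys.
Proof.
elim: w x xs => [x [|y xs]|[[a g] b] w IH x xs].
- by split=> // _; exists [::].
- by split=> // -[[]].
rewrite /=; split.
- case: xs => // z xs [h].
  have sx : size x = a + gdom g + b.
    by have [] := layer_rel_size h; rewrite /wrap !size_cat; lia.
  have [y -> xy /IH[ys -> yr]] := layer_rel_unwrap sx h.
  by exists (y :: ys).
- case=> -[|y ys] -> //= [xy yr].
  split; first exact: layer_rel_wrap.
  by apply/IH; exists ys.
Qed.

Lemma pad_pad a b c d w : pad a b (pad c d w) = pad (a + c) (d + b) w.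
Proof.
rewrite /pad -map_comp; apply: eq_map => -[[e g] f] /=.
by rewrite !addnA.
Qed.

(** The form in which a layer can be checked on explicit lists of colors. *)
Lemma layer_rel_drop a g b x y :
  size x = a + gdom g + b -> size y = a + gcod g + b ->
  take a x = take a y -> drop (a + gdom g) x = drop (a + gcod g) y ->
  gen_rel g (take (gdom g) (drop a x)) (take (gcod g) (drop a y)) ->
  layer_rel (a, g, b) x y.
Proof.
move=> sx sy el er gxy.
rewrite -(cat_take_drop a x) -(cat_take_drop (gdom g) (drop a x)).
rewrite -(cat_take_drop a y) -(cat_take_drop (gcod g) (drop a y)).
rewrite !drop_drop ![_ + a]addnC -el -er; constructor=> //.
- by rewrite size_takel // sx -addnA leq_addr.
- by rewrite size_drop sx addKn.
Qed.

(** The two orders in which distant generators can occur meet the same data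
    [p], [q], [p'], [q'] and differ in the middle level only. *)
Lemma run_exch_lhs g c h x B :
  run x (mlhs (Exch g c h)) B <->
  exists p y p' q q', [/\ x = p ++ y ++ p',
    B = [:: q ++ y ++ p'; q ++ y ++ q'],
    size y = c, gen_rel g p q & gen_rel h p' q'].
Proof.
rewrite /mlhs; split.
- case: B => [[]//|y1 [[_ []]//|y2 [|? ?]]]; last by case=> _ [].
  case=> /layer_relE[L [R [p [q [/size0nil-> sR gpq -> ->]]]]] [] + _.
  case/layer_relE=> [L' [R' [p' [q' [sL' /size0nil-> hpq]]]]].
  have [_ sq] := gen_rel_size gpq; have [sp' _] := gen_rel_size hpq.
  rewrite -(cat_take_drop (gcod g) L') /wrap !cats0 !cat0s -catA.
  have s : size q = size (take (gcod g) L').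
    by rewrite size_takel ?sL' ?leq_addr.
  case/(cat_eq_split s) => <- -> ->.
  exists p, (drop (gcod g) L'), p', q, q'; rewrite -catA; split=> //.
  by rewrite size_drop sL' addKn.
- case=> p [y [p' [q [q' [-> -> <- gpq hpq]]]]].
  have [_ sq] := gen_rel_size gpq; have [sp' _] := gen_rel_size hpq.
  split; first by apply: (@LayerRel _ _ _ [::]); rewrite // size_cat sp'.
  split=> //; rewrite -sq -size_cat.
  rewrite !catA -[_ ++ p']cats0 -[_ ++ q']cats0 -!catA.
  by rewrite [q ++ y ++ p' ++ _]catA [q ++ y ++ q' ++ _]catA; apply: LayerRel.
Qed.

Lemma run_exch_rhs g c h x B :
  run x (mrhs (Exch g c h)) B <->
  exists p y p' q q', [/\ x = p ++ y ++ p',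
    B = [:: p ++ y ++ q'; q ++ y ++ q'],
    size y = c, gen_rel g p q & gen_rel h p' q'].
Proof.
rewrite /mrhs; split.
- case: B => [[]//|y1 [[_ []]//|y2 [|? ?]]]; last by case=> _ [].
  case=> /layer_relE[L' [R' [p' [q' [sL' /size0nil-> hpq -> ->]]]]] [] + _.
  case/layer_relE=> [L [R [p [q [/size0nil-> sR gpq]]]]].
  have [sp _] := gen_rel_size gpq; have [_ sq'] := gen_rel_size hpq.
  rewrite -(cat_take_drop (gdom g) L') /wrap !cats0 !cat0s -catA.
  have s : size (take (gdom g) L') = size p.
    by rewrite size_takel ?sL' ?leq_addr.
  case/(cat_eq_split s) => -> <- ->.
  exists p, (drop (gdom g) L'), p', q, q'; rewrite -!catA; split=> //.
  by rewrite size_drop sL' addKn.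
- case=> p [y [p' [q [q' [-> -> <- gpq hpq]]]]].
  have [sp _] := gen_rel_size gpq; have [_ sq'] := gen_rel_size hpq.
  split; last first.
    by split=> //; apply: (@LayerRel _ _ _ [::]); rewrite // size_cat sq'.
  rewrite -sp -size_cat !catA -[_ ++ p']cats0 -[_ ++ q']cats0 -!catA.
  by rewrite [p ++ y ++ p' ++ _]catA [p ++ y ++ q' ++ _]catA; apply: LayerRel.
Qed.

Lemma run_nilE x B : run x [::] B -> B = [::].
Proof. by case: B. Qed.

Lemma run_consE x l w B : run x (l :: w) B ->
  exists y B', [/\ B = y :: B', layer_rel l x y & run y w B'].
Proof. by case: B => // y B' [xy yB']; exists y, B'. Qed.

(** Solves the coloring equations of a short explicit word: every level becomes a
    list of explicit length, and the only colors left are free parameters. *)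
Ltac inv_run :=
  repeat match goal with
  | H : run _ (_ :: _) ?B |- _ =>
      apply run_consE in H; destruct H as (? & ? & [? ? ?]); subst
  | H : run _ [::] ?B |- _ => apply run_nilE in H; subst
  | H : layer_rel _ _ _ |- _ =>
      apply layer_relE in H; destruct H as (? & ? & ? & ? & [? ? H ? ?]); subst
  | H : gen_rel _ _ _ |- _ => inversion H; clear H; subst
  | H : size ?L = _ |- _ =>
      is_var L; destruct L;
      [ first [discriminate H | clear H]
      | first [discriminate H | injection H as H] ]
  | H : size [::] = _ |- _ => clear H
  | H : [::] = [::] |- _ => clear H
  | H : _ :: _ = _ :: _ |- _ => injection H as; subst
  | H : wrap _ _ _ = _ |- _ => unfold wrap in H; simpl in H
  | H : _ = wrap _ _ _ |- _ => unfold wrap in H; simpl in H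
  | H : _ ++ _ = _ |- _ => progress simpl in H
  | H : _ = _ ++ _ |- _ => progress simpl in H
  end; rewrite /wrap /=.

(** No strand closes up inside the disk of a move: each one ends on the boundary,
    and its colors are determined from there. *)
Lemma move_lhs_uniq r x B B' : size x = mdom r ->
  run x (mlhs r) B -> run x (mlhs r) B' -> last x B = last x B' -> B = B'.
Proof.
case: r => [||[]|[]|[]||g c h] sx h1 h2.
1-9: rewrite /mlhs in h1 h2; move=> E; inv_run.
1-9: by rewrite /wrap /= in E; congruence.
move: h1 h2 sx => /run_exch_lhs[p [y [p' [q [q' [-> -> sy gpq hpq]]]]]].
move=> /run_exch_lhs[p1 [y1 [p1' [q1 [q1' [E -> sy1 gpq1 hpq1]]]]]] _ /= E'.
have [[sp sq] [sp1 sq1]] := (gen_rel_size gpq, gen_rel_size gpq1).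
have /cat_eq_split[|?] := E; first by rewrite sp sp1.
case/cat_eq_split=> [|??]; first by rewrite sy sy1.
have /cat_eq_split[|?] := E'; first by rewrite sq sq1.
by case/cat_eq_split=> [|??]; [rewrite sy sy1 | subst].
Qed.

Lemma move_rhs_uniq r x B B' : size x = mdom r ->
  run x (mrhs r) B -> run x (mrhs r) B' -> last x B = last x B' -> B = B'.
Proof.
case: r => [||[]|[]|[]||g c h] sx h1 h2.
1-9: rewrite /mrhs in h1 h2; move=> E; inv_run.
1-9: by rewrite /wrap /= in E; congruence.
move: h1 h2 sx => /run_exch_rhs[p [y [p' [q [q' [-> -> sy gpq hpq]]]]]].
move=> /run_exch_rhs[p1 [y1 [p1' [q1 [q1' [E -> sy1 gpq1 hpq1]]]]]] _ /= E'.
have [[sp sq] [sp1 sq1]] := (gen_rel_size gpq, gen_rel_size gpq1).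
have /cat_eq_split[|?] := E; first by rewrite sp sp1.
case/cat_eq_split=> [|??]; first by rewrite sy sy1.
have /cat_eq_split[|?] := E'; first by rewrite sq sq1.
by case/cat_eq_split=> [|??]; [rewrite sy sy1 | subst].
Qed.

Hypothesis hX : involutory X.

Lemma qrK (a b : X) : b |> (b |> a) = a.
Proof. by rewrite (hX (b |> a) b) quandle2l. Qed.

(** [s] is the list of levels of the new filling. *)
Ltac fill s :=
  exists s; [repeat split; apply: layer_rel_drop => //=; constructor|];
  rewrite /= ?qrK ?quandle1.

(** The fillings below are found by propagating the colors from the bottom line,
    a cup taking its color from where its strand ends; each case then amounts to
    at most one quandle identity on the top line. *)
Lemma move_fill_lr r x B : size x = mdom r -> run x (mlhs r) B ->
  exists2 B', run x (mrhs r) B' & last x B' = last x B.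
Proof.
case: r => [||[]|[]|[]||g c h] sx h1.
1-9: rewrite /mlhs in h1; inv_run.
- by fill (@nil (seq X)).
- by fill (@nil (seq X)).
- by fill [:: [:: q0 |> a0; q0 |> a0; q0];
    [:: q0 |> a0; q0; q0 |> (q0 |> a0)]].
- by fill [:: [:: a0; a0; q0]; [:: a0; a0 |> q0; a0]].
- by fill [:: [:: a0; a0]].
- by fill [:: [:: a0; a0]].
- by fill (@nil (seq X)).
- by fill (@nil (seq X)).
- fill [:: [:: a1; b1 |> q1; b1]; [:: a1 |> (b1 |> q1); a1; b1];
    [:: a1 |> (b1 |> q1); a1 |> b1; a1]].
  by rewrite quandle3.
move: h1 => /run_exch_lhs[p [y [p' [q [q' [-> -> sy gpq hpq]]]]]].
exists [:: p ++ y ++ q'; q ++ y ++ q'] => //.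
by apply/run_exch_rhs; exists p, y, p', q, q'.
Qed.

Lemma move_fill_rl r x B : size x = mdom r -> run x (mrhs r) B ->
  exists2 B', run x (mlhs r) B' & last x B' = last x B.
Proof.
case: r => [||[]|[]|[]||g c h] sx h1.
1-9: rewrite /mrhs in h1; inv_run.
- by fill [:: [:: q; q; q]; [:: q]].
- by fill [:: [:: q; q; q]; [:: q]].
- by fill [:: [:: q0; q0 |> a0; q0 |> a0];
    [:: q0 |> (q0 |> a0); q0; q0 |> a0]].
- by fill [:: [:: q0; a0; a0]; [:: a0; a0 |> q0; a0]].
- by fill [:: [:: a; a]; [:: a |> a; a]].
- by fill [:: [:: a; a]; [:: a; a |> a]].
- by fill [:: [:: q |> q0; q]; [:: q; q |> (q |> q0)]].
- by fill [:: [:: q0; q0 |> q]; [:: q0 |> (q0 |> q); q0]].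
- fill [:: [:: q1 |> a1; q1; b1]; [:: q1 |> a1; q1 |> b1; q1];
    [:: (q1 |> a1) |> (q1 |> b1); q1 |> a1; q1]].
  by rewrite -quandle3.
move: h1 => /run_exch_rhs[p [y [p' [q [q' [-> -> sy gpq hpq]]]]]].
exists [:: q ++ y ++ p'; q ++ y ++ q'] => //.
by apply/run_exch_lhs; exists p, y, p', q, q'.
Qed.

End Runs.

(** * The action of a move on runs *)

Section Moves.
Context (X : quandle).
Hypothesis hX : involutory X.
Implicit Types (x y z L R : seq X) (A B C xs ys zs : seq (seq X)).
Implicit Types (u v w : word) (s : step) (p q l r : seq step).

Lemma typed_catE m u k v n : typed m u k -> typed m (u ++ v) n = typed k v n.
Proof.
elim: u m => [m /eqP-> //|[[a g] b] u IH m /=].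
by move=> /andP[-> /IH->].
Qed.

Lemma typed_cat_inv m u v n : typed m (u ++ v) n -> exists k, typed m u k.
Proof.
elim: u m => [m _|[[a g] b] u IH m /= /andP[-> /IH//]].
by exists m; apply: eqxx.
Qed.

Lemma typed_padE a b m w n :
  typed (a + m + b) (pad a b w) (a + n + b) = typed m w n.
Proof.
elim: w m => [|[[c g] d] w IH] m /=; first by rewrite eqn_add2r eqn_add2l.
have -> : a + c + gcod g + (d + b) = a + (c + gcod g + d) + b by lia.
rewrite IH; congr andb; apply/eqP/eqP; lia.
Qed.

Lemma typed_pad_ge a b m w n :
  typed m (pad a b w) (a + n + b) -> exists k, m = a + k + b.
Proof.
case: w => [|[[c g] d] w /= /andP[/eqP-> _]]; first by move=> /eqP->; exists n.
exists (c + gdom g + d); lia.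
Qed.

(** The move keeps [A] below the disk and [C] above it. Its result is described
    rather than computed, so that inverting a move or placing it in a larger
    diagram requires no choice. *)
Inductive move_act s x : seq (seq X) -> seq (seq X) -> Prop :=
| MoveAct A B B' C :
    run x (sbelow s) A ->
    run (last x A) (pad (sleft s) (sright s) (sin s)) B ->
    run (last x A) (pad (sleft s) (sright s) (sout s)) B' ->
    last (last x A) B' = last (last x A) B ->
    run (last (last x A) B) (sabove s) C ->
    move_act s x (A ++ B ++ C) (A ++ B' ++ C).

(** The half of [step_typed] that concerns the part below the disk: it suffices
    for the disk to meet as many strands as the move expects. *)
Definition step_at m s :=
  typed m (sbelow s) (sleft s + mdom (smove s) + sright s).

Lemma step_typed_at m n s : step_typed m n s -> step_at m s.
Proof. by case/andP. Qed.

Lemma sin_sinv s : sin (sinv s) = sout s.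
Proof. by rewrite /sin /sout /=; case: sdir. Qed.

Lemma sout_sinv s : sout (sinv s) = sin s.
Proof. by rewrite /sin /sout /=; case: sdir. Qed.

Lemma ssrc_sinv s : ssrc (sinv s) = stgt s.
Proof. by rewrite /ssrc sin_sinv. Qed.

Lemma sinvK s : sinv (sinv s) = s.
Proof. by case: s => *; rewrite /sinv /= negbK. Qed.

Lemma move_act_sym s x xs ys : move_act s x xs ys -> move_act (sinv s) x ys xs.
Proof.
case=> A B B' C rA rB rB' e rC.
by apply: MoveAct; rewrite ?sin_sinv ?sout_sinv ?e.
Qed.

Lemma move_act_src s x xs ys : move_act s x xs ys -> run x (ssrc s) xs.
Proof.
case=> A B B' C rA rB rB' e rC; apply/run_catE; exists A, (B ++ C); split=> //.
by apply/run_catE; exists B, C.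
Qed.

Lemma move_act_tgt s x xs ys : move_act s x xs ys -> run x (stgt s) ys.
Proof.
by move=> /move_act_sym/move_act_src; rewrite ssrc_sinv.
Qed.

Lemma move_act_last s x xs ys : move_act s x xs ys -> last x ys = last x xs.
Proof. by case=> A B B' C _ _ _ e _; rewrite !last_cat e. Qed.

Lemma move_fill s x B : size x = mdom (smove s) -> run x (sin s) B ->
  exists2 B', run x (sout s) B' & last x B' = last x B.
Proof.
by rewrite /sin /sout; case: sdir; [apply: move_fill_lr | apply: move_fill_rl].
Qed.

Lemma move_uniq s x B B' : size x = mdom (smove s) ->
  run x (sout s) B -> run x (sout s) B' -> last x B = last x B' -> B = B'.
Proof.
by rewrite /sout; case: sdir; [apply: move_rhs_uniq | apply: move_lhs_uniq].
Qed.

Lemma split_wrap a m b x : size x = a + m + b ->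
  exists L y R, [/\ x = wrap L R y, size L = a, size y = m & size R = b].
Proof.
move=> sx; exists (take a x), (take m (drop a x)), (drop (a + m) x).
rewrite /wrap addnC -drop_drop !cat_take_drop; split=> //.
- by rewrite size_takel //; lia.
- by rewrite size_takel // size_drop; lia.
- by rewrite !size_drop; lia.
Qed.

Lemma last_wrap L R x xs :
  last (wrap L R x) (map (wrap L R) xs) = wrap L R (last x xs).
Proof. exact: last_map. Qed.

Lemma wrap_inj L R : injective (wrap L R).
Proof.
move=> x y /[dup]/(congr1 size); rewrite /wrap !size_cat => E.
have sxy : size x = size y by lia.
by move=> /(cat_eq_split erefl)[_] /(cat_eq_split sxy)[].
Qed.

(** Totality and functionality of the action are the existence and uniqueness of
    the filling of the disk; the colors beside the disk are set apart first. *)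
Lemma move_act_total s x xs : step_at (size x) s -> run x (ssrc s) xs ->
  exists ys, move_act s x xs ys.
Proof.
move=> ts /run_catE[A [D [-> rA /run_catE[B [C [-> rB rC]]]]]].
have /split_wrap[L [y [R [ey sL sy sR]]]] := run_typed ts erefl rA.
move: rB; rewrite ey -sL -sR => /run_wrap[B0 eB rB0].
have [B1 rB1 eB1] := move_fill sy rB0.
exists (A ++ map (wrap L R) B1 ++ C); apply: MoveAct => //.
- by rewrite ey -sL -sR; apply/run_wrap; exists B0.
- by rewrite ey -sL -sR; apply/run_wrap; exists B1.
- by rewrite ey eB !last_wrap eB1.
Qed.

Lemma move_act_fun s x xs ys zs : step_at (size x) s ->
  move_act s x xs ys -> move_act s x xs zs -> ys = zs.
Proof.
move=> ts; case=> A B B1 C rA rB rB1 e1 rC h.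
inversion h as [A' B' B2 C' rA' rB' rB2 e2 rC' E E'].
subst zs; clear h; move: E.
case/(cat_eq_split (etrans (run_size rA') (esym (run_size rA)))) => ?; subst A'.
case/(cat_eq_split (etrans (run_size rB') (esym (run_size rB)))) => ? ?.
subst B' C'.
have /split_wrap[L [y [R [ey sL sy sR]]]] := run_typed ts erefl rA.
move: rB1 rB2 e1 e2; rewrite ey -sL -sR.
move=> /run_wrap[B0 -> rB0] /run_wrap[B0' -> rB0'].
rewrite !last_wrap => e1 e2; congr (_ ++ (map _ _ ++ _)).
by apply: (move_uniq sy rB0 rB0'); apply: (@wrap_inj L R); rewrite e1 e2.
Qed.

End Moves.

(** * The action of a movie, and its invariance *)

Section Movies.
Context (X : quandle).
Implicit Types (x y z L R : seq X) (A B C xs ys zs : seq (seq X)).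
Implicit Types (u v w : word) (s : step) (p q l r : seq step).

Lemma move_act_vwhisk u v s z A x xs ys C :
  run z u A -> last z A = x -> move_act s x xs ys -> run (last x xs) v C ->
  move_act (vwhisk u v s) z (A ++ xs ++ C) (A ++ ys ++ C).
Proof.
move=> rA <- [A0 B B' C0 rA0 rB rB' e rC0].
rewrite !last_cat => rC; rewrite -!catA (catA A) [A ++ A0 ++ B' ++ _]catA.
apply: MoveAct; rewrite /= ?last_cat //; apply/run_catE.
- by exists A, A0.
- by exists C0, C.
Qed.

Lemma run_map_wrap L R w x xs : run x w xs ->
  run (wrap L R x) (pad (size L) (size R) w) (map (wrap L R) xs).
Proof. by move=> r; apply/run_wrap; exists xs. Qed.

Lemma move_act_hwhisk L R s x xs ys : move_act s x xs ys ->
  move_act (hwhisk (size L) (size R) s) (wrap L R x)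
    (map (wrap L R) xs) (map (wrap L R) ys).
Proof.
case=> A B B' C rA rB rB' e rC; rewrite !map_cat.
apply: MoveAct; rewrite /= ?last_wrap -?pad_pad; try exact: run_map_wrap.
by rewrite e.
Qed.

Fixpoint movie_act p x xs ys : Prop :=
  if p is s :: p' then exists2 zs, move_act s x xs zs & movie_act p' x zs ys
  else xs = ys.

Lemma movie_act_cat p q x xs ys :
  movie_act (p ++ q) x xs ys <->
  exists2 zs, movie_act p x xs zs & movie_act q x zs ys.
Proof.
elim: p xs => [|s p IH] xs /=; first by split=> [|[? ->]]; first exists xs.
split=> [[zs h /IH[ts]]|[ts [zs h hp hq]]]; first by exists ts => //; exists zs.
by exists zs => //; apply/IH; exists ts.
Qed.

Lemma movie_act_last p x xs ys : movie_act p x xs ys -> last x ys = last x xs.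
Proof.
by elim: p xs => [|s p IH] xs /= => [->|[zs /move_act_last <- /IH]].
Qed.

Lemma movie_act_vwhisk u v p z A x xs ys C :
  run z u A -> last z A = x -> run (last x xs) v C -> movie_act p x xs ys ->
  movie_act (map (vwhisk u v) p) z (A ++ xs ++ C) (A ++ ys ++ C).
Proof.
move=> rA eA; elim: p xs => [xs _ -> //|s p IH] xs rC /= [zs h hp].
exists (A ++ zs ++ C); first exact: move_act_vwhisk h rC.
by apply: IH; rewrite // (move_act_last h).
Qed.

Lemma movie_act_hwhisk L R p x xs ys : movie_act p x xs ys ->
  movie_act (map (hwhisk (size L) (size R)) p) (wrap L R x)
    (map (wrap L R) xs) (map (wrap L R) ys).
Proof.
elim: p xs => [xs -> //|s p IH] xs /= [zs /(move_act_hwhisk L R) h /IH hp].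
by exists (map (wrap L R) zs).
Qed.

(** In the source the generator [h] sits on top of the run of [w], in the target
    below it; the run of [w] itself is the same, with the upper instead of the
    lower colors of [h] beside it. The induction exchanges [h] with the layers
    of [w] one at a time, starting from the top. *)
Lemma slide_right_act h (p q : seq X) w x xs : gen_rel h p q -> run x w xs ->
  movie_act (slide_right h w) (wrap [::] p x)
    (rcons (map (wrap [::] p) xs) (wrap [::] q (last x xs)))
    (wrap [::] q x :: map (wrap [::] q) xs).
Proof.
move=> hpq; have [sp sq] := gen_rel_size hpq.
elim: w x xs => [|[[a g] b] w IH] x [|y xs] //= [xy yxs].
apply/movie_act_cat.
exists [:: wrap [::] p y, wrap [::] q y & map (wrap [::] q) xs].
  have := @movie_act_vwhisk [:: (a, g, b + gdom h)] [::] _ (wrap [::] p x)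
    [:: wrap [::] p y] _ _ _ [::] _ _ _ (IH _ _ yxs).
  rewrite !cats0; apply=> //; split=> //.
  by have := layer_rel_wrap [::] p xy; rewrite sp.
exists (wrap [::] q x :: wrap [::] q y :: map (wrap [::] q) xs) => //.
have [L [R [p0 [q0 [sL sR gpq -> ey]]]]] := layer_relE xy.
have ez c z : wrap [::] c (wrap L R z) = wrap L [::] (z ++ R ++ c).
  by rewrite /wrap !cats0 /= -!catA.
rewrite ey !ez.
apply: (@MoveAct _ _ _ [::]
  (map (wrap L [::]) [:: q0 ++ R ++ p; q0 ++ R ++ q])
  (map (wrap L [::]) [:: p0 ++ R ++ q; q0 ++ R ++ q])
  (map (wrap [::] q) xs)) => //; subst a b.
- apply/(run_wrap L [::] (mlhs (Exch g (size R) h))).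
  eexists; first reflexivity.
  by apply/run_exch_lhs; exists p0, R, p, q0, q.
- apply/(run_wrap L [::] (mrhs (Exch g (size R) h))).
  eexists; first reflexivity.
  by apply/run_exch_rhs; exists p0, R, p, q0, q.
- rewrite /= -ez -ey -sq; exact: (run_map_wrap [::] q yxs).
Qed.

(** The mirror image: here [h] starts below and rises, so the layers of [w] are
    passed from the bottom. *)
Lemma slide_left_act h (p q : seq X) w x xs : gen_rel h p q -> run x w xs ->
  movie_act (slide_left h w) (wrap p [::] x)
    (wrap q [::] x :: map (wrap q [::]) xs)
    (rcons (map (wrap p [::]) xs) (wrap q [::] (last x xs))).
Proof.
move=> hpq; have [sp sq] := gen_rel_size hpq.
elim: w x xs => [|[[a g] b] w IH] x [|y xs] //= [xy yxs].
exists [:: wrap p [::] y, wrap q [::] y & map (wrap q [::]) xs]; last first.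
  have := @movie_act_vwhisk [:: (gdom h + a, g, b)] [::] _ (wrap p [::] x)
    [:: wrap p [::] y] _ _ _ [::] _ _ _ (IH _ _ yxs).
  rewrite !cats0; apply=> //; split=> //.
  by have := layer_rel_wrap p [::] xy; rewrite sp addn0.
have [L [R [p0 [q0 [sL sR gpq -> ey]]]]] := layer_relE xy.
have ez c z : wrap c [::] (wrap L R z) = wrap [::] R (c ++ L ++ z).
  by rewrite /wrap !cats0 /= -!catA.
rewrite ey !ez.
apply: (@MoveAct _ _ _ [::]
  (map (wrap [::] R) [:: q ++ L ++ p0; q ++ L ++ q0])
  (map (wrap [::] R) [:: p ++ L ++ q0; q ++ L ++ q0])
  (map (wrap q [::]) xs)) => //; subst a b.
- apply/(run_wrap [::] R (mlhs (Exch h (size L) g))).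
  eexists; first reflexivity.
  by apply/run_exch_lhs; exists p, L, p0, q, q0.
- apply/(run_wrap [::] R (mrhs (Exch h (size L) g))).
  eexists; first reflexivity.
  by apply/run_exch_rhs; exists p, L, p0, q, q0.
- rewrite /= -ez -ey -sq; exact: (run_map_wrap q [::] yxs).
Qed.

Lemma pad_cat a b u v : pad a b (u ++ v) = pad a b u ++ pad a b v.
Proof. exact: map_cat. Qed.

Lemma ssrc_hwhisk a b s : ssrc (hwhisk a b s) = pad a b (ssrc s).
Proof. by rewrite /ssrc !pad_cat pad_pad. Qed.

Lemma step_at_hwhisk a b m s : step_at (a + m + b) (hwhisk a b s) = step_at m s.
Proof.
rewrite /step_at /= -(typed_padE a b m).
have -> : a + (sleft s + mdom (smove s) + sright s) + b
  = a + sleft s + mdom (smove s) + (sright s + b) by lia.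
by [].
Qed.

Lemma step_at_vwhisk m k u v s :
  typed m u k -> step_at m (vwhisk u v s) = step_at k s.
Proof. by move=> h; rewrite /step_at /= (typed_catE _ _ h). Qed.

Lemma typed_inj_src m m' w n : typed m w n -> typed m' w n -> m = m'.
Proof.
by case: w => [/eqP-> /eqP->|[[a g] b] w /andP[/eqP-> _] /andP[/eqP-> _]].
Qed.

Hypothesis hX : involutory X.

(** The two moves act on different segments of the run, and the first one does
    not change the level where the second segment starts. *)
Lemma rel_commute_act s s' x xs :
  step_at (size x) s -> step_at (size x) (vwhisk (stgt s) [::] s') ->
  run x (ssrc s ++ ssrc s') xs ->
  exists ys,
    movie_act [:: vwhisk [::] (ssrc s') s; vwhisk (stgt s) [::] s'] x xs ys /\
    movie_act [:: vwhisk (ssrc s) [::] s'; vwhisk [::] (stgt s') s] x xs ys.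
Proof.
move=> hs hs' /run_catE[A [B [-> rA rB]]].
have [A' hA] := move_act_total hX hs rA.
have [k tk] := typed_cat_inv hs'.
have sk : size (last x A') = k := run_typed tk erefl (move_act_tgt hA).
have [B' hB] : exists B', move_act s' (last x A) B B'.
  apply: (move_act_total hX) rB.
  by rewrite -(move_act_last hA) sk -(step_at_vwhisk [::] _ tk).
exists (A' ++ B'); split.
- exists (A' ++ B).
    exact: (move_act_vwhisk (u := [::]) (A := [::]) (z := x)) hA rB.
  exists (A' ++ B') => //; rewrite -(move_act_last hA) in hB.
  have := move_act_vwhisk (v := [::]) (C := [::]) (move_act_tgt hA) erefl hB I.
  by rewrite !cats0.
- exists (A ++ B').
    have := move_act_vwhisk (v := [::]) (C := [::]) rA erefl hB I.
    by rewrite !cats0.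
  exists (A' ++ B') => //.
  have rB' := move_act_tgt hB.
  exact: (move_act_vwhisk (u := [::]) (A := [::]) (z := x)) hA rB'.
Qed.

(** If the move takes the run [A0] to [B0], both movies end in [B0] lying above
    [h], with the upper colors [q] of [h] beside it. *)
Lemma rel_slide_right_act m n s h x xs : step_typed m n s ->
  size x = m + gdom h ->
  run x (ssrc (vwhisk [::] [:: (n, h, 0)] (hwhisk 0 (gdom h) s))) xs ->
  exists ys,
    movie_act (vwhisk [::] [:: (n, h, 0)] (hwhisk 0 (gdom h) s)
                 :: slide_right h (stgt s)) x xs ys /\
    movie_act (rcons (slide_right h (ssrc s))
                 (vwhisk [:: (m, h, 0)] [::] (hwhisk 0 (gcod h) s))) x xs ys.
Proof.
move=> ts sx; have tw := ssrc_typed ts.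
have /split_wrap[L0 [y [p [-> /size0nil-> sy sp]]]] : size x = 0 + m + gdom h.
  by [].
rewrite ssrc_vwhisk ssrc_hwhisk cat0s -sp => /run_catE[A [B [-> rA rB]]].
move: rA rB => /(run_wrap [::])[A0 -> rA0]; rewrite last_wrap.
have sl := run_typed tw sy rA0.
case: B => [[]//|z [|? ?]] [] //.
move=> /layer_relE[L [R [p' [q [sL /size0nil-> hpq E ez]]]]] _.
subst z; have E' : last y A0 = L /\ p = p'.
  by apply: cat_eq_split; [rewrite sl sL | move: E; rewrite /wrap /= cats0].
case: E' => <- ?; subst p' => {E L sL}.
have [_ sq] := gen_rel_size hpq.
have [B0 hB] : exists B0, move_act s y A0 B0.
  by apply: (move_act_total hX) rA0; rewrite sy; apply: step_typed_at ts.
have ew c z : wrap z [::] c = wrap [::] c z by rewrite /wrap cats0.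
have lB : last y B0 = last y A0 by apply: move_act_last hB.
have top c c' : gen_rel h c c' ->
    run (wrap [::] c (last y A0)) [:: (n, h, 0)] [:: wrap [::] c' (last y A0)].
  by move=> hc; rewrite -!ew; split=> //; apply: LayerRel.
have bot c c' : gen_rel h c c' ->
    run (wrap [::] c y) [:: (m, h, 0)] [:: wrap [::] c' y].
  by move=> hc; rewrite -!ew; split=> //; apply: LayerRel.
exists (wrap [::] q y :: map (wrap [::] q) B0); split.
- exists (map (wrap [::] p) B0 ++ [:: wrap [::] q (last y A0)]).
    have hp := move_act_hwhisk [::] p hB; rewrite sp in hp *.
    have := move_act_vwhisk (u := [::]) (A := [::]) (v := [:: (n, h, 0)])
      I erefl hp.
    by rewrite last_wrap ew; apply; apply: top.
  by rewrite cats1 -lB; apply: slide_right_act hpq (move_act_tgt hB).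
- rewrite -cats1; apply/movie_act_cat.
  exists (wrap [::] q y :: map (wrap [::] q) A0).
    by rewrite ew cats1; apply: slide_right_act.
  exists (wrap [::] q y :: map (wrap [::] q) B0) => //.
  have hq := move_act_hwhisk [::] q hB; rewrite sq in hq *.
  have := move_act_vwhisk (v := [::]) (C := [::]) (bot _ _ hpq) erefl hq I.
  by rewrite !cats0.
Qed.

Lemma rel_slide_left_act m n s h x xs : step_typed m n s ->
  size x = gdom h + m ->
  run x (ssrc (vwhisk [:: (0, h, m)] [::] (hwhisk (gcod h) 0 s))) xs ->
  exists ys,
    movie_act (vwhisk [:: (0, h, m)] [::] (hwhisk (gcod h) 0 s)
                 :: slide_left h (stgt s)) x xs ys /\
    movie_act (rcons (slide_left h (ssrc s))
                 (vwhisk [::] [:: (0, h, n)] (hwhisk (gdom h) 0 s))) x xs ys.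
Proof.
move=> ts sx; have tw := ssrc_typed ts.
have /split_wrap[p [y [R0 [-> sp sy /size0nil->]]]] : size x = gdom h + m + 0.
  by rewrite addn0.
rewrite ssrc_vwhisk ssrc_hwhisk cats0.
case: xs => [[]//|z A [/layer_relE[L [R [p' [q [/size0nil-> sR hpq E ->]]]]]]].
have [sp' sq] := gen_rel_size hpq.
have E' : p = p' /\ y = R.
  by apply: cat_eq_split; [rewrite sp sp' | move: E; rewrite /wrap !cats0].
case: E' => ? ?; subst p' R => {E sR sp'}.
have ew c z' : wrap [::] z' c = wrap c [::] z' by rewrite /wrap cats0.
rewrite ew -sq => /(run_wrap _ [::])[A0 -> rA0].
have [B0 hB] : exists B0, move_act s y A0 B0.
  by apply: (move_act_total hX) rA0; rewrite sy; apply: step_typed_at ts.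
have lB : last y B0 = last y A0 by apply: move_act_last hB.
have top c c' : gen_rel h c c' ->
    run (wrap c [::] (last y A0)) [:: (0, h, n)] [:: wrap c' [::] (last y A0)].
  move=> hc; rewrite -!ew; split=> //; apply: LayerRel => //.
  exact: run_typed tw sy rA0.
have bot c c' : gen_rel h c c' ->
    run (wrap c [::] y) [:: (0, h, m)] [:: wrap c' [::] y].
  by move=> hc; rewrite -!ew; split=> //; apply: LayerRel.
exists (rcons (map (wrap p [::]) B0) (wrap q [::] (last y B0))); split.
- exists (wrap q [::] y :: map (wrap q [::]) B0).
    have hq := move_act_hwhisk q [::] hB; rewrite sq in hq *.
    have := move_act_vwhisk (v := [::]) (C := [::]) (bot _ _ hpq) erefl hq I.
    by rewrite !cats0.
  exact: slide_left_act hpq (move_act_tgt hB).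
- rewrite -cats1; apply/movie_act_cat.
  exists (rcons (map (wrap p [::]) A0) (wrap q [::] (last y A0))).
    exact: slide_left_act.
  exists (rcons (map (wrap p [::]) B0) (wrap q [::] (last y B0))) => //.
  have hp := move_act_hwhisk p [::] hB; rewrite sp in hp *.
  rewrite lB -!cats1.
  have := move_act_vwhisk (u := [::]) (A := [::]) (v := [:: (0, h, n)])
    I erefl hp.
  by rewrite last_wrap; apply; apply: top.
Qed.

Lemma movie_act_total m n f p g x xs : chain m n f p g -> size x = m ->
  run x f xs -> exists ys, movie_act p x xs ys.
Proof.
move=> + sx; elim: p f xs => [f xs _ _|s p IH f xs /= [-> ts pg] fxs].
  by exists xs.
have [zs hz] : exists zs, move_act s x xs zs.
  by apply: move_act_total fxs => //; rewrite sx; apply: step_typed_at ts.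
have [ys hy] := IH _ _ pg (move_act_tgt hz).
by exists ys, zs.
Qed.

Lemma movie_act_fun m n f p g x xs ys zs : chain m n f p g -> size x = m ->
  movie_act p x xs ys -> movie_act p x xs zs -> ys = zs.
Proof.
move=> + sx; elim: p f xs => [f xs _ /= <- //|s p IH f xs /= [_ ts pg]].
move=> [xs1 h1 p1] [xs2 h2 p2].
have tx : step_at (size x) s by rewrite sx; apply: step_typed_at ts.
by rewrite -(move_act_fun tx h1 h2) in p2; apply: IH pg p1 p2.
Qed.

Lemma movie_act_tgt m n f p g x xs ys : chain m n f p g ->
  run x f xs -> movie_act p x xs ys -> run x g ys.
Proof.
elim: p f xs => [f xs /= <- + <- //|s p IH f xs /= [_ ts pg] _ [zs hz]].
exact: IH pg (move_act_tgt hz).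
Qed.

(** A common result is all that is needed, as both actions are functional. *)
Lemma movie_rel_act s l r x xs : movie_rel (s :: l) r ->
  all (step_at (size x)) (s :: l) -> run x (ssrc s) xs ->
  exists ys, movie_act (s :: l) x xs ys /\ movie_act r x xs ys.
Proof.
move=> h /=/andP[hs hl] hx; inversion h; subst.
- have [ys hys] := move_act_total hX hs hx.
  exists xs; split=> //; exists ys => //; exists xs => //.
  exact: move_act_sym.
- move: hl; rewrite /= andbT => hl.
  have hs0 : step_at (size x) s0 by [].
  by apply: rel_commute_act => //; move: hx; rewrite ssrc_vwhisk.
- apply: (rel_slide_right_act (m := m) (n := n)) => //.
  have := step_typed_at H2; rewrite -(step_at_hwhisk 0 (gdom h0)) add0n.
  by move=> hm; exact: typed_inj_src hs hm.
- apply: (rel_slide_left_act (m := m) (n := n)) => //.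
  by case/andP: hs => /eqP.
Qed.

Lemma chain_catE m n f p q g : chain m n f (p ++ q) g <->
  exists h, chain m n f p h /\ chain m n h q g.
Proof.
elim: p f => [|s p IH] f /=; first by split=> [|[h [->]]]; first exists f.
split=> [[-> ts /IH[h [hp hq]]]|[h [[-> ts hp] hq]]]; first by exists h.
by split=> //; apply/IH; exists h.
Qed.

Lemma chain_all m n f p g : chain m n f p g -> all (step_typed m n) p.
Proof. by elim: p f => [|s p IH] f //= [_ -> /IH]. Qed.

Lemma movie_rel_nonempty l r : movie_rel l r -> exists s l', l = s :: l'.
Proof. by case=> *; do 2!eexists. Qed.

(** Restricting a run to the place where the relation is applied takes three
    cuts: in time, by [p] and [q]; vertically, by [u] and [v]; and horizontally,
    by the colors [L] and [R] of the strands beside. *)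
Lemma movie_step_act m n (f g : tangle m n) (P Q : movie f g) x xs :
  movie_step P Q -> size x = m -> run x f xs ->
  exists ys, movie_act P x xs ys /\ movie_act Q x xs ys.
Proof.
case=> {}P {}Q p q u v a b l r lr eP eQ sx fxs.
have := movie_chain P; rewrite eP => /chain_catE[h1 [c1]].
move=> /chain_catE[h2 [c2 c3]].
have [xs1 a1] := movie_act_total c1 sx fxs.
have r1 := movie_act_tgt c1 fxs a1.
have [s [l' el]] := movie_rel_nonempty lr; subst l.
have := chain_all c2; rewrite all_map => al.
have [e1 ts _] := c2; rewrite e1 ssrc_vwhisk ssrc_hwhisk in r1.
case/andP: ts => /= ts _.
have [k tk] := typed_cat_inv ts.
have [k' ek] : exists k', k = a + k' + b.
  rewrite (typed_catE _ _ tk) in ts; apply: typed_pad_ge.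
  have e n0 n1 n2 : a + n0 + n1 + (n2 + b) = a + (n0 + n1 + n2) + b by lia.
  by rewrite e in ts; apply: ts.
have /run_catE[A [D [eD rA /run_catE[M [C [eM rM rC]]]]]] := r1; subst.
have /split_wrap[L [y [R [ey sL sy sR]]]] : size (last x A) = a + k' + b.
  exact: run_typed tk erefl rA.
move: rM; rewrite ey -{1}sL -{1}sR => /run_wrap[M0 eM rM0].
have aly : all (step_at (size y)) (s :: l').
  apply: sub_all al => t /=/step_typed_at.
  by rewrite (step_at_vwhisk _ _ tk) step_at_hwhisk sy.
have [N [hl hr]] := movie_rel_act lr aly rM0.
have key t : movie_act t y M0 N -> movie_act (map (vwhisk u v \o hwhisk a b) t)
   x (A ++ M ++ C) (A ++ map (wrap L R) N ++ C).
  move=> ht; rewrite map_comp; apply: movie_act_vwhisk rA erefl rC _.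
  by rewrite ey eM -sL -sR; apply: movie_act_hwhisk.
have r2 : run x h2 (A ++ map (wrap L R) N ++ C).
  by apply: movie_act_tgt c2 _ (key _ hl); rewrite ssrc_vwhisk ssrc_hwhisk.
have [ys hq] := movie_act_total c3 erefl r2.
have glue t : movie_act t y M0 N ->
    movie_act (p ++ map (vwhisk u v \o hwhisk a b) t ++ q) x xs ys.
  move=> ht; apply/movie_act_cat; exists (A ++ M ++ C); first by [].
  by apply/movie_act_cat; exists (A ++ map (wrap L R) N ++ C); first exact: key.
by exists ys; rewrite eQ; split; [exact: (glue (s :: l')) | exact: glue].
Qed.

Lemma movie_eq_act m n (f g : tangle m n) (P Q : movie f g) x xs ys :
  eclass (@movie_step m n f g) P Q -> size x = m -> run x f xs ->
  movie_act P x xs ys <-> movie_act Q x xs ys.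
Proof.
move=> PQ sx fxs; elim: PQ => {P Q}[P Q PQ|P|P Q _ IH|P Q S _ IH1 _ IH2] //.
- have [zs [hP hQ]] := movie_step_act PQ sx fxs; split=> h.
  + by rewrite (movie_act_fun (movie_chain P) sx h hP).
  + by rewrite (movie_act_fun (movie_chain Q) sx h hQ).
- by split=> /IH.
- by split=> [/IH1/IH2|/IH2/IH1].
Qed.

End Movies.

(** * Colorings are runs *)

Section Onth.
Context (T : Type).
Implicit Types s : seq T.

Lemma onth_drop n s i : onth (drop n s) i = onth s (n + i).
Proof. by rewrite !onthE map_drop nth_drop. Qed.

Lemma onth_take n s i : onth (take n s) i = if i < n then onth s i else None.
Proof.
rewrite !onthE map_take; case: ltnP => [h|h]; first by rewrite nth_take.
by rewrite nth_default // size_take size_map; case: ltnP => //; lia.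
Qed.

Lemma take2_drop n s u v : onth s n = Some u -> onth s n.+1 = Some v ->
  take 2 (drop n s) = [:: u; v].
Proof.
move=> su sv; apply: eq_from_onth => -[|[|i]]; rewrite onth_take onth_drop.
- by rewrite addn0 su.
- by rewrite addn1 sv.
- by rewrite /= onth0n.
Qed.

Lemma onth_cat_size s1 s2 i : onth (s1 ++ s2) (size s1 + i) = onth s2 i.
Proof. by rewrite onth_cat ltnNge leq_addr /= addKn. Qed.

End Onth.

Section Colorings.
Context (X : quandle).
Implicit Types (x y z L R : seq X) (A B C xs ys zs : seq (seq X)).
Implicit Types (u v w : word) (s : step) (p q l r : seq step).

(** The levels of a run as a function on all heights, which is how a coloring
    provides them. *)
Definition locally_colored w (S : nat -> seq X) : Prop :=
  forall i (l : layer), onth w i = Some l -> layer_rel l (S i) (S i.+1).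

Lemma run_locally x w xs : run x w xs <->
  size xs = size w /\ locally_colored w (nth [::] (x :: xs)).
Proof.
elim: w x xs => [|l w IH] x [|y xs]; try by split=> // -[].
  by split=> // _; split=> // i l; rewrite onth0n.
split=> [[xy /IH[sxs h]]|[[sxs] h]].
  by split=> [|[|i] k]; [rewrite /= sxs | case=> <- | apply: h].
split; first exact: (h 0).
by apply/IH; split=> // i k; apply: (h i.+1).
Qed.

Lemma onth_wrap0 L R x : onth (wrap L R x) (size L) = onth (x ++ R) 0.
Proof. by rewrite -[size L]addn0 onth_cat_size. Qed.

Lemma onth_wrap1 L R x : onth (wrap L R x) (size L).+1 = onth (x ++ R) 1.
Proof. by rewrite -addn1 onth_cat_size. Qed.

Lemma locally_colored_joined w S a b : locally_colored w S -> joined w a b ->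
  onth (S a.1) a.2 = onth (S b.1) b.2.
Proof.
move=> h []; rewrite /fst /snd.
- move=> i c g d j /h/layer_relE[L [R [p [q [sL sR _ -> ->]]]]] lt.
  by rewrite /wrap !onth_cat sL lt.
- move=> i c g d j /h/layer_relE[L [R [p [q [<- sR gpq -> ->]]]]] lt.
  have [<- <-] := gen_rel_size gpq.
  by rewrite /wrap -!addnA !onth_cat_size.
- move=> i c d /h/layer_relE[L [R [p [q [<- sR gpq -> ->]]]]].
  by inversion gpq; rewrite !(onth_wrap0, onth_wrap1).
- move=> i c d /h/layer_relE[L [R [p [q [<- sR gpq -> ->]]]]].
  by inversion gpq; rewrite !(onth_wrap0, onth_wrap1).
- move=> i c d /h/layer_relE[L [R [p [q [<- sR gpq _ ->]]]]].
  by inversion gpq; rewrite !(onth_wrap0, onth_wrap1).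
- move=> i c d /h/layer_relE[L [R [p [q [<- sR gpq -> _]]]]].
  by inversion gpq; rewrite !(onth_wrap0, onth_wrap1).
Qed.

Lemma locally_colored_crossing w S o a b :
  locally_colored w S -> crossing w o a b ->
  exists vo va, [/\ onth (S o.1) o.2 = Some vo, onth (S a.1) a.2 = Some va
    & onth (S b.1) b.2 = Some (vo |> va)].
Proof.
move=> h []; rewrite /fst /snd => i c d.
- move=> /h/layer_relE[L [R [p [q [<- sR gpq -> ->]]]]]; inversion gpq; subst.
  by exists a0, b0; rewrite !(onth_wrap0, onth_wrap1).
- move=> /h/layer_relE[L [R [p [q [<- sR gpq -> ->]]]]]; inversion gpq; subst.
  by exists b0, a0; rewrite !(onth_wrap0, onth_wrap1).
Qed.

(** [width] is read from the layer below a level; typing makes the layer above it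
    agree. *)
Lemma width_layer m w n i a g b : typed m w n -> onth w i = Some (a, g, b) ->
  width m w i = a + gdom g + b.
Proof.
elim: w m i => [|[[c k] d] w IH] m i; first by rewrite onth0n.
move=> /= /andP[/eqP em tw]; case: i => [[<- <- <-] //|i h].
by rewrite -(IH _ _ tw h); case: i {h}.
Qed.

Section OneTangle.
Context (m n : nat) (T : tangle m n).
Implicit Types c : coloring X T.

Definition level_point i (j : 'I_(width m T i)) : point T :=
  exist _ (i, j : nat) (ltn_ord j).

(** A tuple over the points of the level avoids a default color, which an empty
    quandle could not supply. Above the diagram the levels are empty. *)
Definition level c i : seq X :=
  [tuple sval c (arc_of (level_point j)) | j < width m T i].

Lemma size_level c i : size (level c i) = width m T i.
Proof. exact: size_tuple. Qed.

Lemma onth_level c (p : point T) :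
  onth (level c (val p).1) (val p).2 = Some (sval c (arc_of p)).
Proof.
case: p => -[i j] ij; apply/(tnth_onth _ _ (Ordinal ij)).
rewrite tnth_mktuple; congr (sval c (arc_of _)); exact: val_inj.
Qed.

Lemma color_at_level c i j : color_at c i j = onth (level c i) j.
Proof.
rewrite /color_at; case: insubP => [p _ e|]; first by rewrite -onth_level e.
by rewrite /is_point /= -leqNgt => le; rewrite onth_default ?size_level.
Qed.

Lemma level_joined c a b : joined T a b -> is_point m T a -> is_point m T b ->
  onth (level c a.1) a.2 = onth (level c b.1) b.2.
Proof.
move=> ab ha hb.
rewrite (onth_level c (exist _ a ha)) (onth_level c (exist _ b hb)).
by congr (Some (sval c _)); apply/eq_qpi/rst_step.
Qed.

Lemma level_crossing c o a b : crossing T o a b ->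
  is_point m T o -> is_point m T a -> is_point m T b ->
  exists vo va, [/\ onth (level c o.1) o.2 = Some vo,
    onth (level c a.1) a.2 = Some va
    & onth (level c b.1) b.2 = Some (vo |> va)].
Proof.
move=> oab ho ha hb; do 2!eexists; split.
- exact: (onth_level c (exist _ o ho)).
- exact: (onth_level c (exist _ a ha)).
- rewrite (onth_level c (exist _ b hb)); congr Some.
  exact: (proj2_sig c (exist _ o ho) (exist _ a ha) (exist _ b hb)).
Qed.

Lemma level_locally c : locally_colored T (level c).
Proof.
move=> i [[a g] b] Ti; have wi := width_layer (tangle_typed T) Ti.
have wS : width m T i.+1 = a + gcod g + b by rewrite /= Ti.
have pi j : j < a + gdom g + b -> is_point m T (i, j).
  by rewrite /is_point /= wi.
have pS j : j < a + gcod g + b -> is_point m T (i.+1, j).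
  by rewrite /is_point wS.
apply: layer_rel_drop; rewrite ?size_level //.
- apply: eq_from_onth => j; rewrite !onth_take; case: ltnP => // lt.
  apply: (level_joined c (joined_left Ti lt)); first by apply: pi; lia.
  by apply: pS; lia.
- apply: eq_from_onth => j; rewrite !onth_drop; have [lt|ge] := ltnP j b.
    apply: (level_joined c (joined_right Ti lt)); first by apply: pi; lia.
    by apply: pS; lia.
  by rewrite !onth_default ?size_level ?wi ?wS //; lia.
- case: g Ti wi wS pi pS => [[]||] Ti wi wS pi pS; rewrite /gdom /gcod /=.
  + have [] := level_crossing c (crossing_right Ti);
      try by [apply: pi => /=; lia | apply: pS => /=; lia].
    move=> vo [va [eo ea eb]]; rewrite (take2_drop eo ea).
    have ej := level_joined c (joined_over_right Ti).
    rewrite (take2_drop eb (etrans (esym (ej _ _)) eo)); first by constructor.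
      by apply: pi => /=; lia.
    by apply: pS => /=; lia.
  + have [] := level_crossing c (crossing_left Ti);
      try by [apply: pi => /=; lia | apply: pS => /=; lia].
    move=> vo [va [eo ea eb]]; rewrite (take2_drop ea eo).
    have ej := level_joined c (joined_over_left Ti).
    rewrite (take2_drop (etrans (esym (ej _ _)) eo) eb); first by constructor.
      by apply: pi => /=; lia.
    by apply: pS => /=; lia.
  + have h0 : is_point m T (i.+1, a) by apply: pS => /=; lia.
    have h1 : is_point m T (i.+1, a.+1) by apply: pS => /=; lia.
    have e0 := onth_level c (exist _ (_, _) h0 : point T).
    have e1 := level_joined c (joined_cup Ti) h0 h1; rewrite e0 in e1.
    by rewrite take0 (take2_drop e0 (esym e1)); constructor.
  + have h0 : is_point m T (i, a) by apply: pi => /=; lia.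
    have h1 : is_point m T (i, a.+1) by apply: pi => /=; lia.
    have e0 := onth_level c (exist _ (_, _) h0 : point T).
    have e1 := level_joined c (joined_cap Ti) h0 h1; rewrite e0 in e1.
    by rewrite take0 (take2_drop e0 (esym e1)); constructor.
Qed.

Definition upper_levels c : seq (seq X) :=
  [seq level c i | i <- iota 1 (size T)].

Lemma nth_upper_levels c i :
  nth [::] (level c 0 :: upper_levels c) i = level c i.
Proof.
have [lt|ge] := ltnP i (size T).+1.
  by rewrite -[_ :: _]/(mkseq (level c) (size T).+1) nth_mkseq.
rewrite nth_default /= ?size_map ?size_iota //; apply/esym/size0nil.
rewrite size_level; case: i ge => // i ge /=.
by rewrite onth_default.
Qed.

Lemma run_levels c : run (level c 0) T (upper_levels c).
Proof.
apply/run_locally; split; first by rewrite size_map size_iota.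
by move=> i l /(level_locally c); rewrite !nth_upper_levels.
Qed.

Lemma coloring_inj c c' :
  level c 0 = level c' 0 -> upper_levels c = upper_levels c' -> c = c'.
Proof.
move=> e0 es; have e i : level c i = level c' i.
  by rewrite -(nth_upper_levels c) -(nth_upper_levels c') e0 es.
have E : sval c = sval c'.
  apply: funext => q; rewrite -(qreprK q).
  by apply: Some_inj; rewrite -!(onth_level _ (qrepr q)) e.
case: c c' E {e0 es e} => [f fP] [g gP] /= E; subst g.
by rewrite (Prop_irrelevance fP gP).
Qed.

Lemma run_size_width x xs i : size x = m -> run x T xs ->
  size (nth [::] (x :: xs) i) = width m T i.
Proof.
move=> sx /run_locally[ss h]; case: i => [|i]; first exact: sx.
rewrite [width _ _ _]/=.
case E : (onth T i) => [[[a g] b]|].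
  by have [_ ->] := layer_rel_size (h _ _ E).
by rewrite nth_default //= ss ltnS -onthNE E.
Qed.

(** A run colors points; it colors arcs because points joined inside one layer
    have equal colors, and hence so have all points of an arc. *)
Lemma coloring_of_run x xs : size x = m -> run x T xs ->
  exists c, level c 0 = x /\ upper_levels c = xs.
Proof.
move=> sx r; have sw i := run_size_width i sx r.
have /run_locally[ss h] := r.
pose S := nth [::] (x :: xs).
have fP (p : point T) : {a | onth (S (val p).1) (val p).2 = Some a}.
  case E : (onth _ _) => [a|]; first by exists a.
  have := valP p; rewrite /is_point -sw -/S -onthTE.
  by rewrite E.
pose f (p : point T) := projT1 (fP p).
have fE (p : point T) : onth (S (val p).1) (val p).2 = Some (f p).
  exact: projT2 (fP p).
pose g (q : Defs.arc T) := f (qrepr q).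
have fJ a b : eclass (fun p q : point T => joined T (val p) (val q)) a b ->
    f a = f b.
  elim=> // [{}a {}b ab|{}a {}b d _ -> _ -> //].
  by apply: Some_inj; rewrite -!fE; apply: locally_colored_joined ab.
have gE (p : point T) : g (arc_of p) = f p by apply: fJ; apply: qreprP.
have gP (o u u' : point T) : crossing T (val o) (val u) (val u') ->
    g (arc_of u') = g (arc_of o) |> g (arc_of u).
  move=> hc; rewrite !gE.
  have [vo [va []]] := locally_colored_crossing h hc.
  by rewrite !fE => -[->] [->] [->].
pose c : coloring X T := exist _ g gP.
have lc i : level c i = S i.
  apply: eq_from_onth => j; have [lt|ge] := ltnP j (width m T i).
    have ij : is_point m T (i, j) by [].
    rewrite (onth_level c (exist _ (i, j) ij)) /= gE.
    by rewrite -fE.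
  by rewrite !onth_default ?size_level ?sw.
exists c; split; first exact: lc.
apply: (@eq_from_nth _ [::]); first by rewrite size_map size_iota ss.
move=> i _; have := nth_upper_levels c i.+1; rewrite /= => ->; exact: lc.
Qed.

End OneTangle.
End Colorings.

(** * Agreement outside a disk *)

Section Agreement.
Context (X : quandle).

Section Split.
Context (m n : nat) (T : tangle m n) (c : coloring X T) (A C : seq (seq X)).
Hypothesis cAC : upper_levels c = A ++ C.

Lemma level_lower i : i < size A -> level c i.+1 = nth [::] A i.
Proof.
by move=> lt; have := nth_upper_levels c i.+1; rewrite /= cAC nth_cat lt => <-.
Qed.

Lemma level_upper i : level c (size A + i).+1 = nth [::] C i.
Proof.
have := nth_upper_levels c (size A + i).+1; rewrite /= cAC nth_cat => <-.
by rewrite ltnNge leq_addr addKn.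
Qed.

Lemma level_between : level c (size A) = last (level c 0) A.
Proof.
by rewrite (last_nth [::]) -nth_upper_levels cAC -cat_cons nth_cat ltnSn.
Qed.

End Split.

(** Equal levels up to the bottom of the disk give the common part [A], equal
    levels above its top the common part [C]; equality at the top of the disk
    itself is the condition on the two fillings. *)
Lemma agree_outsideE m n (s : disk_move m n)
    (c : coloring X (dm_src s)) (c' : coloring X (dm_tgt s)) :
  agree_outside c c' <->
  level c' 0 = level c 0 /\
  move_act s (level c 0) (upper_levels c) (upper_levels c').
Proof.
(* Levels are determined by their entries, so the second index can go. *)
have E : agree_outside c c' <->
  (forall i, i <= size (sbelow s) -> level c i = level c' i) /\
  (forall i, level c (size (sbelow s) + size (sin s) + i)
             = level c' (size (sbelow s) + size (sout s) + i)).
  split=> -[lo hi]; split.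
  - by move=> i le; apply: eq_from_onth => j; rewrite -!color_at_level lo.
  - by move=> i; apply: eq_from_onth => j; rewrite -!color_at_level hi.
  - by move=> i j le; rewrite !color_at_level lo.
  - by move=> i j; rewrite !color_at_level hi.
rewrite E {E}; split.
- move=> [lo hi].
  have e0 : level c' 0 = level c 0 by rewrite lo.
  split=> //.
  have /run_catE[A [D [eA rA]]] := run_levels c.
  move=> /run_catE[B [C [eD rB rC]]].
  have /run_catE[A' [D' [eA' rA']]] := run_levels c'.
  move=> /run_catE[B' [C' [eD' rB' rC']]].
  subst D D'; rewrite e0 in rA' rB' rC'.
  have sz w x (E : seq (seq X)) a b : run x (pad a b w) E -> size E = size w.
    by move/run_size; rewrite size_map.
  have eqA : A' = A.
    apply: (@eq_from_nth _ [::]); first by rewrite (run_size rA) (run_size rA').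
    move=> i lt; rewrite -(level_lower eA') // -(level_lower eA) -?lo //.
      by rewrite -(run_size rA').
    by rewrite (run_size rA) -(run_size rA').
  subst A'; rewrite !catA in eA eA'.
  have sAB : size (A ++ B) = size (sbelow s) + size (sin s).
    by rewrite size_cat (run_size rA) (sz _ _ _ _ _ rB).
  have sAB' : size (A ++ B') = size (sbelow s) + size (sout s).
    by rewrite size_cat (run_size rA) (sz _ _ _ _ _ rB').
  have eqC : C' = C.
    apply: (@eq_from_nth _ [::]); first by rewrite (run_size rC) (run_size rC').
    move=> i _; rewrite -(level_upper eA') -(level_upper eA) sAB sAB'.
    by rewrite -!addnS hi.
  subst C'; rewrite eA eA' -!catA; apply: MoveAct => //.
  rewrite -!last_cat -{1}e0 -(level_between eA) -(level_between eA') sAB sAB'.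
  by rewrite -[_ + size (sout s)]addn0 -hi addn0.
- move=> [e0]; move E : (upper_levels c) => xs.
  move E' : (upper_levels c') => ys h.
  case: h E E' => A B B' C rA rB rB' e rC E E'.
  have sA := run_size rA.
  have sB : size B = size (sin s) by rewrite (run_size rB) size_map.
  have sB' : size B' = size (sout s) by rewrite (run_size rB') size_map.
  split=> [[|i] le|i]; first by [].
    by rewrite (level_lower E) ?sA // (level_lower E') ?sA.
  rewrite -sA -sB -sB'; rewrite !catA in E E'.
  rewrite -!size_cat; case: i => [|i].
    by rewrite !addn0 (level_between E) (level_between E') !last_cat e0 e.
  by rewrite !addnS (level_upper E) (level_upper E').
Qed.

End Agreement.

(** * The 2-functor *)

#[local] Obligation Tactic := idtac.

Section Functor.
Context (X : quandle).

(** The inverse bijection automatically commutes with the legs. *)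
Lemma span_invertible (A B : Type) (S S' : span A B) (u : span_cell S S') :
  (forall x y, u x = u y -> x = y) -> (forall y, exists x, u x = y) ->
  @invertible SpanSet A B S S' u.
Proof.
move=> inj_u sur_u; pose v y := projT1 (cid (sur_u y)).
have vK y : u (v y) = y by apply: projT2 (cid (sur_u y)).
have vl y : legl S (v y) = legl S' y by rewrite -{2}[y]vK span_mapl.
have vr y : legr S (v y) = legr S' y by rewrite -{2}[y]vK span_mapr.
exists (SpanCell vl vr); split; apply: span_cell_eq => x /=; last exact: vK.
by apply: inj_u; rewrite vK.
Qed.

Lemma level_last m n (T : tangle m n) (c : coloring X T) :
  last (level c 0) (upper_levels c) = level c (size T).
Proof. by rewrite (last_nth [::]) nth_upper_levels size_map size_iota. Qed.

Lemma legl_level m n (T : tangle m n) (c : coloring X T) :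
  legl (Col X T) c = level c 0 :> seq X.
Proof.
apply: eq_from_onth => j; have [lt|ge] := ltnP j m.
  rewrite (onth_level c (bottom_point T (Ordinal lt))).
  by apply/(tnth_onth _ _ (Ordinal lt)); rewrite tnth_mktuple.
by rewrite !onth_default ?size_tuple.
Qed.

Lemma legr_level m n (T : tangle m n) (c : coloring X T) :
  legr (Col X T) c = last (level c 0) (upper_levels c) :> seq X.
Proof.
rewrite level_last; apply: eq_from_onth => j; have [lt|ge] := ltnP j n.
  rewrite (onth_level c (top_point T (Ordinal lt))).
  by apply/(tnth_onth _ _ (Ordinal lt)); rewrite tnth_mktuple.
by rewrite !onth_default ?size_level ?size_tuple ?(width_top (tangle_typed T)).
Qed.

Lemma size_level0 m n (T : tangle m n) (c : coloring X T) :
  size (level c 0) = m.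
Proof. exact: size_level. Qed.

(** Whatever keeps the bottom and the top line of a run defines a 2-morphism of
    spans. *)
Lemma legs_eq m n (T T' : tangle m n) (c : coloring X T) (c' : coloring X T') :
  level c' 0 = level c 0 ->
  last (level c 0) (upper_levels c') = last (level c 0) (upper_levels c) ->
  legl (Col X T') c' = legl (Col X T) c
  /\ legr (Col X T') c' = legr (Col X T) c.
Proof.
by move=> e0 el; split; apply: val_inj; rewrite /= ?legl_level ?legr_level ?e0.
Qed.

Hypothesis hX : involutory X.

Lemma Col_movie_ex m n (f g : tangle m n) (P : movie f g) (c : coloring X f) :
  {c' : coloring X g |
    level c' 0 = level c 0 /\
    movie_act P (level c 0) (upper_levels c) (upper_levels c')}.
Proof.
apply: cid; have rc := run_levels c; have s0 := size_level0 c.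
have [ys hy] := movie_act_total hX (movie_chain P) s0 rc.
have [c' [e0 es]] := coloring_of_run s0 (movie_act_tgt (movie_chain P) rc hy).
by exists c'; rewrite es.
Qed.

Program Definition Col_movie m n (f g : tangle m n) (P : movie f g) :
    span_cell (Col X f) (Col X g) :=
  @SpanCell _ _ (Col X f) (Col X g) (fun c => sval (Col_movie_ex P c)) _ _.
Next Obligation.
move=> m n f g P c; have [e0 /movie_act_last el] := svalP (Col_movie_ex P c).
exact: (legs_eq e0 el).1.
Qed.
Next Obligation.
move=> m n f g P c; have [e0 /movie_act_last el] := svalP (Col_movie_ex P c).
exact: (legs_eq e0 el).2.
Qed.

Section OneMovie.
Context (m n : nat) (f g : tangle m n).
Implicit Types (P Q : movie f g) (c : coloring X f).

Lemma Col_movie0 P c : level (Col_movie P c : coloring X g) 0 = level c 0.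
Proof. by have [] := svalP (Col_movie_ex P c). Qed.

Lemma Col_movie_act P c :
  movie_act P (level c 0) (upper_levels c)
    (upper_levels (Col_movie P c : coloring X g)).
Proof. by have [] := svalP (Col_movie_ex P c). Qed.

(** The characterization through which every identity between 2-morphisms below
    is proved. *)
Lemma Col_movie_uniq P c (c' : coloring X g) : level c' 0 = level c 0 ->
  movie_act P (level c 0) (upper_levels c) (upper_levels c') ->
  Col_movie P c = c'.
Proof.
move=> e0 h; apply: coloring_inj; first by rewrite Col_movie0.
exact: movie_act_fun (movie_chain P) (size_level0 c) (Col_movie_act P c) h.
Qed.

Lemma Col_movie_eq P Q : P ~m Q -> Col_movie P = Col_movie Q.
Proof.
move=> PQ; apply: span_cell_eq => c.
apply: Col_movie_uniq; first exact: Col_movie0.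
apply/(movie_eq_act hX _ PQ (size_level0 c) (run_levels c)).
exact: Col_movie_act.
Qed.

Definition Col_cell (x : tang_cell f g) : span_cell (Col X f) (Col X g) :=
  Col_movie (qrepr x).

(** The action does not depend on the chosen representative of the class. *)
Lemma Col_cellE P : Col_cell (qpi _ P) = Col_movie P.
Proof. exact/Col_movie_eq/qreprP. Qed.

End OneMovie.

Lemma Col_movie_nil m n (f g : tangle m n) (fg : f = g :> word)
    (c : coloring X f) :
  upper_levels (Col_movie (movie_nil fg) c : coloring X g) = upper_levels c.
Proof. by have /= <- := Col_movie_act (movie_nil fg) c. Qed.

Section Composite.
Context (m k n : nat) (f : tangle m k) (g : tangle k n).

(** Agreement in the pullback means that the second run starts where the first
    one ends. *)
Lemma pullback_level (p : pullback (Col X f) (Col X g)) :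
  level ((sval p).2 : coloring X g) 0 =
  last (level ((sval p).1 : coloring X f) 0)
    (upper_levels ((sval p).1 : coloring X f)).
Proof.
by case: p => -[c d] /= /(congr1 val) /=; rewrite legl_level legr_level.
Qed.

Lemma Col_glue_ex (p : pullback (Col X f) (Col X g)) :
  {e : coloring X (tangle_comp f g) |
    level e 0 = level ((sval p).1 : coloring X f) 0 /\
    upper_levels e = upper_levels ((sval p).1 : coloring X f)
               ++ upper_levels ((sval p).2 : coloring X g)}.
Proof.
apply: cid; case: p => -[c d] /= /(congr1 val) /=.
rewrite legl_level legr_level => cd.
apply: coloring_of_run; first exact: size_level0.
apply/run_catE; exists (upper_levels c), (upper_levels d).
by rewrite cd; split=> //; apply: run_levels.
Qed.

Program Definition Col_glue :
    span_cell (span_comp1 (Col X f) (Col X g)) (Col X (tangle_comp f g)) :=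
  @SpanCell _ _ (span_comp1 (Col X f) (Col X g)) (Col X (tangle_comp f g))
    (fun p => sval (Col_glue_ex p)) _ _.
Next Obligation.
move=> p; have [e0 es] := svalP (Col_glue_ex p); apply: val_inj.
by rewrite /= !legl_level.
Qed.
Next Obligation.
move=> p; have [e0 es] := svalP (Col_glue_ex p); apply: val_inj.
by rewrite /= !legr_level e0 es last_cat -pullback_level.
Qed.

Lemma Col_glue0 p : level (Col_glue p : coloring X (tangle_comp f g)) 0
  = level ((sval p).1 : coloring X f) 0.
Proof. by have [] := svalP (Col_glue_ex p). Qed.

Lemma Col_glue_upper p :
  upper_levels (Col_glue p : coloring X (tangle_comp f g))
  = upper_levels ((sval p).1 : coloring X f)
    ++ upper_levels ((sval p).2 : coloring X g).
Proof. by have [] := svalP (Col_glue_ex p). Qed.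

(** A run of the composite word splits in exactly one way, since the number of
    layers of [f] is known. *)
Lemma Col_glue_inv : @invertible SpanSet _ _ _ _ Col_glue.
Proof.
apply: span_invertible.
- move=> p q pq; have := Col_glue0 q; have := Col_glue_upper q.
  rewrite -pq Col_glue0 Col_glue_upper.
  have ss (r : pullback (Col X f) (Col X g)) :
      size (upper_levels ((sval r).1 : coloring X f)) = size f.
    by rewrite size_map size_iota.
  case/(cat_eq_split (etrans (ss p) (esym (ss q)))) => e1 e2 e0.
  have := pullback_level p; rewrite e0 e1 -(pullback_level q) => e3.
  apply: pullback_eq; apply: injective_projections; exact: coloring_inj.
- move=> e; have /run_catE[A [B [eAB rA rB]]] := run_levels e.
  have [c [c0 cs]] := coloring_of_run (size_level0 e) rA.
  have sA : size (last (level e 0) A) = k.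
    exact: run_typed (tangle_typed f) (size_level0 e) rA.
  have [d [d0 ds]] := coloring_of_run sA rB.
  have cd : legr (Col X f) c = legl (Col X g) d.
    by apply: val_inj; rewrite /= legl_level legr_level c0 cs d0.
  exists (exist _ (c, d) cd : pullback (Col X f) (Col X g)).
  by apply: coloring_inj; rewrite ?Col_glue0 ?Col_glue_upper /= ?c0 ?cs ?ds.
Qed.

End Composite.

Lemma Col_unit_ex n (x : Col_ob X n) :
  {c : coloring X (tangle_id n) | level c 0 = x /\ upper_levels c = [::]}.
Proof. by apply: cid; apply: coloring_of_run; first exact: size_tuple. Qed.

Program Definition Col_unit n :
    span_cell (span_id1 (Col_ob X n)) (Col X (tangle_id n)) :=
  @SpanCell _ _ (span_id1 (Col_ob X n)) (Col X (tangle_id n))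
    (fun x => sval (Col_unit_ex x)) _ _.
Next Obligation.
move=> n x; have [c0 _] := svalP (Col_unit_ex x); apply: val_inj.
by rewrite /= legl_level.
Qed.
Next Obligation.
move=> n x; have [c0 cs] := svalP (Col_unit_ex x); apply: val_inj.
by rewrite /= legr_level c0 cs.
Qed.

Lemma Col_unit0 n x : level (@Col_unit n x : coloring X (tangle_id n)) 0 = x.
Proof. by have [] := svalP (Col_unit_ex x). Qed.

Lemma Col_unit_upper n x :
  upper_levels (@Col_unit n x : coloring X (tangle_id n)) = [::].
Proof. by have [] := svalP (Col_unit_ex x). Qed.

Lemma Col_unit_inv n : @invertible SpanSet _ _ _ _ (@Col_unit n).
Proof.
apply: span_invertible => [x y xy|c].
- by apply: val_inj; rewrite /= -Col_unit0 xy Col_unit0.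
- exists (legl (Col X (tangle_id n)) c).
  by apply: coloring_inj; rewrite ?Col_unit0 ?legl_level // Col_unit_upper.
Qed.

Lemma movie_act_hcomp m k n (f f' : tangle m k) (g g' : tangle k n)
    (P : movie f f') (Q : movie g g') (x : seq X)
    (xs xs' ys ys' : seq (seq X)) :
  run x f' xs' -> run (last x xs) g ys ->
  movie_act P x xs xs' -> movie_act Q (last x xs) ys ys' ->
  movie_act (movie_hcomp P Q) x (xs ++ ys) (xs' ++ ys').
Proof.
move=> rx ry hP hQ; apply/movie_act_cat; exists (xs' ++ ys).
  exact: (movie_act_vwhisk (u := [::]) (A := [::]) I erefl ry hP).
rewrite -(movie_act_last hP) in hQ.
have := movie_act_vwhisk (v := [::]) (C := [::]) rx erefl I hQ.
by rewrite !cats0.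
Qed.

(** A horizontal composite of movies plays the first one below and then the
    second one above, hence acts on the two parts of a run separately. *)
Lemma Col_glue_nat m k n (f f' : tangle m k) (g g' : tangle k n)
    (x : tang_cell f f') (y : tang_cell g g') :
  span_vcomp (span_hcomp (Col_cell x) (Col_cell y)) (Col_glue f' g')
  = span_vcomp (Col_glue f g) (Col_cell (tang_hcomp x y)).
Proof.
apply: span_cell_eq => p; apply/esym; rewrite /tang_hcomp Col_cellE.
apply: Col_movie_uniq; first by rewrite !Col_glue0 [LHS]Col_movie0.
rewrite !Col_glue_upper Col_glue0; apply: movie_act_hcomp.
- by rewrite -(Col_movie0 (qrepr x)); apply: run_levels.
- by rewrite -pullback_level; apply: run_levels.
- exact: Col_movie_act.
- by rewrite -pullback_level; apply: Col_movie_act.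
Qed.

Lemma Col_assoc m k l n (f : tangle m k) (g : tangle k l) (h : tangle l n) :
  span_vcomp (span_vcomp (span_hcomp (Col_glue f g) (span_id2 (Col X h)))
      (Col_glue (tangle_comp f g) h)) (Col_cell (tang_assoc f g h))
  = span_vcomp (span_vcomp (span_assoc (Col X f) (Col X g) (Col X h))
      (span_hcomp (span_id2 (Col X f)) (Col_glue g h)))
      (Col_glue f (tangle_comp g h)).
Proof.
apply: span_cell_eq => p; rewrite /tang_assoc Col_cellE; apply: coloring_inj.
  rewrite [LHS]Col_movie0 [LHS]Col_glue0 [RHS]Col_glue0; exact: Col_glue0.
rewrite [LHS]Col_movie_nil [LHS]Col_glue_upper [RHS]Col_glue_upper.
apply: etrans (congr1 (cat^~ _) (Col_glue_upper _)) _.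
apply: etrans _ (congr1 (cat _) (esym (Col_glue_upper _))).
exact/esym/catA.
Qed.

Lemma Col_lunit m n (f : tangle m n) :
  span_vcomp (span_vcomp (span_hcomp (Col_unit m) (span_id2 (Col X f)))
      (Col_glue (tangle_id m) f)) (Col_cell (tang_lunit f))
  = span_lunit (Col X f).
Proof.
apply: span_cell_eq => p; rewrite /tang_lunit Col_cellE; apply: coloring_inj.
  rewrite [LHS]Col_movie0 [LHS]Col_glue0 [LHS]Col_unit0.
  by case: p => -[x c] /= ->; rewrite legl_level.
rewrite [LHS]Col_movie_nil [LHS]Col_glue_upper.
exact: (congr1 (cat^~ _) (Col_unit_upper _)).
Qed.

Lemma Col_runit m n (f : tangle m n) :
  span_vcomp (span_vcomp (span_hcomp (span_id2 (Col X f)) (Col_unit n))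
      (Col_glue f (tangle_id n))) (Col_cell (tang_runit f))
  = span_runit (Col X f).
Proof.
apply: span_cell_eq => p; rewrite /tang_runit Col_cellE; apply: coloring_inj.
  by rewrite [LHS]Col_movie0 [LHS]Col_glue0.
rewrite [LHS]Col_movie_nil [LHS]Col_glue_upper.
exact: etrans (congr1 (cat _) (Col_unit_upper _)) (cats0 _).
Qed.

Lemma Col_cell_id m n (f : tangle m n) :
  Col_cell (tang_id2 f) = span_id2 (Col X f).
Proof.
by rewrite /tang_id2 Col_cellE; apply: span_cell_eq => c; apply: Col_movie_uniq.
Qed.

Lemma Col_cell_vcomp m n (f g h : tangle m n)
    (x : tang_cell f g) (y : tang_cell g h) :
  Col_cell (tang_vcomp x y) = span_vcomp (Col_cell x) (Col_cell y).
Proof.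
rewrite /tang_vcomp Col_cellE; apply: span_cell_eq => c.
apply: Col_movie_uniq; first exact: etrans (Col_movie0 _ _) (Col_movie0 _ _).
apply/movie_act_cat; eexists; first exact: Col_movie_act.
rewrite -(Col_movie0 (qrepr x)); exact: Col_movie_act.
Qed.

Definition Col_functor : @pseudofunctor Tang SpanSet (Col_ob X) (@Col X) :=
  @Pseudofunctor Tang SpanSet (Col_ob X) (@Col X) (@Col_cell) (@Col_cell_id)
    (@Col_cell_vcomp) (@Col_glue) (@Col_unit) (@Col_glue_inv) (@Col_unit_inv)
    (@Col_glue_nat) (@Col_assoc) (@Col_lunit) (@Col_runit).

Lemma Col_functor_dm m n (s : disk_move m n)
    (c : coloring X (dm_src s)) (c' : coloring X (dm_tgt s)) :
  F2 Col_functor (dm_cell s) c = c' <->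
  level c' 0 = level c 0 /\
  move_act s (level c 0) (upper_levels c) (upper_levels c').
Proof.
have -> : F2 Col_functor (dm_cell s) = Col_movie (Movie (dm_chain s)).
  exact: Col_cellE.
split=> [<-|[e0 h]].
  split; first exact: Col_movie0.
  by have /= [zs hz <-] := Col_movie_act (Movie (dm_chain s)) c.
by apply: Col_movie_uniq => //; exists (upper_levels c').
Qed.

End Functor.

Lemma bijective_of_inj_surj (T U : Type) (phi : T -> U) :
  injective phi -> (forall y, exists x, phi x = y) -> bijective phi.
Proof.
move=> inj_phi sur; pose psi y := projT1 (cid (sur y)).
have psiK y : phi (psi y) = y by apply: projT2 (cid (sur y)).
by exists psi => // x; apply: inj_phi; rewrite psiK.
Qed.

(** The action of the inverse move provides the injectivity and the surjectivity
    of the action of a move. *)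
Theorem theorem5p3 (X : quandle) (hX : involutory X) :
  exists F : @pseudofunctor Tang SpanSet (Col_ob X) (@Col X),
  forall (m n : nat) (s : disk_move m n),
    let phi : coloring X (dm_src s) -> coloring X (dm_tgt s) :=
      span_map (F2 F (dm_cell s)) in
    bijective phi
    /\ forall c : coloring X (dm_src s), unique (agree_outside c) (phi c).
Proof.
exists (Col_functor hX) => m n s phi.
have phiE := @Col_functor_dm X hX m n s.
split; last first.
  move=> c; split; first by apply/agree_outsideE/phiE.
  by move=> c' /agree_outsideE/phiE.
apply: bijective_of_inj_surj.
- move=> c c' cc'; have /phiE[e0 h] := erefl (phi c).
  have /phiE[e0' h'] := erefl (phi c'); rewrite -cc' in e0' h'.
  have ec : level c 0 = level c' 0 by rewrite -e0 e0'.
  rewrite -ec in h'; apply: coloring_inj => //.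
  have ts : step_at (size (level c 0)) (sinv s).
    by rewrite size_level0; apply: step_typed_at (dm_typed s).
  exact: move_act_fun ts (move_act_sym h) (move_act_sym h').
- move=> c'; have rc' := run_levels c'; rewrite -[tword _]ssrc_sinv in rc'.
  have ts : step_at (size (level c' 0)) (sinv s).
    by rewrite size_level0; apply: step_typed_at (dm_typed s).
  have [xs /move_act_sym] := move_act_total hX ts rc'; rewrite sinvK => h.
  have [c [e0 es]] :=
    coloring_of_run (T := dm_src s) (size_level0 c') (move_act_src h).
  by exists c; apply/phiE; rewrite e0 es.
Qed.
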